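(* Consider the three-term arithmetic progression models $P^{\mathrm{cyc}}_{\beta,h}$ and $P^{\mathrm{int}}_{\beta,h}$ with reference measure $\mu=\frac12\delta_0+\frac12\delta_1$. (i) In the cyclic case $A=A^{\mathrm{cyc}}$, with $X\sim P^{\mathrm{cyc}}_{\beta_0,h_0}$: (a) If $\beta_0>0$ and $h_0\ge0$, then $T_N(X)=o_p(1)$ under $P^{\mathrm{cyc}}_{\beta_0,h_0}$. (b) For every $h_0\in\mathbb R$ there exists $L=L(h_0)>0$ such that, whenever $\beta_0\le-L$, there is a constant $c>0$ with $P^{\mathrm{cyc}}_{\beta_0,h_0}(T_N(X)\ge c)\to1$. Consequently, the maximum pseudo-likelihood estimator (MPLE) exists with probability tending to one and is jointly $\sqrt N$-consistent for $(\beta_0,h_0)$. (ii) In the integer case $A=A^{\mathrm{int}}$, with $X\sim P^{\mathrm{int}}_{\beta_0,h_0}$: for every fixed $(\beta_0,h_0)\in\mathbb R^2$, $T_N(X)=\Omega_p(1)$ under $P^{\mathrm{int}}_{\beta_0,h_0}$. Consequently, the MPLE exists with probability tending to one and is jointly $\sqrt N$-consistent for $(\beta_0,h_0)$.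
   Context: A nontrivial 3-AP in $\mathbb Z$ is a triple $(a,b,c)$ of distinct integers with $a+c=2b$; a nontrivial 3-AP in $\mathbb Z/N\mathbb Z$ is a triple of pairwise distinct residues with $a+c\equiv2b\pmod N$. A set $\{a,b,c\}$ ''forms a nontrivial 3-AP'' if some ordering of its elements is a nontrivial 3-AP. For $a,b,c\in[N]$ (identified with residues mod $N$ in the cyclic case) put $$A^{\mathrm{int}}_{abc}=\tfrac1N\mathbf 1\{\{a,b,c\}\text{ forms a nontrivial 3-AP in }\mathbb Z\},\quad A^{\mathrm{cyc}}_{abc}=\tfrac1N\mathbf 1\{\{a,b,c\}\text{ forms a nontrivial 3-AP in }\mathbb Z/N\mathbb Z\}.$$ For $A\in\{A^{\mathrm{int}},A^{\mathrm{cyc}}\}$ the corresponding Gibbs measure ($P^{\mathrm{int}}_{\beta,h}$ or $P^{\mathrm{cyc}}_{\beta,h}$) on $\{0,1\}^N$ is $$\frac{dP_{\beta,h}}{d\mu^{\otimes N}}(x)=\frac1{Z_N(\beta,h)}\exp\Big(\frac\beta3\sum_{i,j,k}A_{ijk}x_ix_jx_k+h\sum_ix_i\Big),\qquad\mu=\tfrac12\delta_0+\tfrac12\delta_1 .$$ Put $m_i(x)=\sum_{j,k}A_{ijk}x_jx_k$, $\bar m(x)=\frac1N\sum_im_i(x)$, $T_N(x)=\frac1N\sum_i(m_i(x)-\bar m(x))^2$, and $\Lambda(\lambda)=\log\frac{1+e^\lambda}2$. MPLE: given $x$, $(\hat\beta,\hat h)$ is the unique solution $(\beta,h)\in\mathbb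 R^2$ (if there is a unique solution, in which case it is said to exist) of $$\sum_i m_i(x)\big(x_i-\Lambda'(\beta m_i(x)+h)\big)=0,\qquad \sum_i\big(x_i-\Lambda'(\beta m_i(x)+h)\big)=0.$$ Jointly $\sqrt N$-consistent means $\max(|\hat\beta-\beta_0|,|\hat h-h_0|)=O_p(N^{-1/2})$ under the true law. $o_p(1)$ means convergence to $0$ in probability; $T_N(X)=\Omega_p(1)$ means that the probability of $\{T_N(X)\le\varepsilon_N\}$ tends to $0$ for every deterministic sequence $\varepsilon_N\to0$. All asymptotics are as $N\to\infty$. *)

(* Defs.v *)
From mathcomp Require Import all_boot all_order all_algebra.
From mathcomp Require Import all_classical all_reals all_analysis.
Set Implicit Arguments.
Unset Strict Implicit.
Unset Printing Implicit Defensive.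
Import Order.TTheory GRing.Theory Num.Theory.
Import numFieldNormedType.Exports.
Local Open Scope ring_scope.

(* The sites [N] = {1, ..., N} are indexed from 0, by 'I_N; this is harmless
   since both notions of progression are invariant under translation. *)

Definition ap_int N (a b c : 'I_N) : bool :=
  [&& a != b, b != c, a != c & (a + c == 2 * b)%N].

(* Distinct elements of 'I_N are distinct residues modulo N. *)
Definition ap_cyc N (a b c : 'I_N) : bool :=
  [&& a != b, b != c, a != c & (a + c == 2 * b %[mod N])%N].

Definition forms_ap N (ap : 'I_N -> 'I_N -> 'I_N -> bool) (S : {set 'I_N}) :
    bool :=
  [exists a, exists b, exists c, (S == [set a; b; c]) && ap a b c].

Definition tensor (R : realType) (N : nat) := 'I_N -> 'I_N -> 'I_N -> R.

Definition A_int (R : realType) (N : nat) : tensor R N := fun a b c =>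
  N%:R^-1 * (forms_ap (@ap_int N) [set a; b; c])%:R.

Definition A_cyc (R : realType) (N : nat) : tensor R N := fun a b c =>
  N%:R^-1 * (forms_ap (@ap_cyc N) [set a; b; c])%:R.

(* {0,1}^N; a coordinate x i : bool is read as the real number (x i)%:R. *)
Definition config (N : nat) := {ffun 'I_N -> bool}.

Arguments A_int : clear implicits.
Arguments A_cyc : clear implicits.

Section Gibbs.
Variables (R : realType) (N : nat) (A : tensor R N).
Implicit Types (x : config N) (beta h : R).

(* Point masses of mu = (delta_0 + delta_1) / 2 and of its N-fold product. *)
Definition mu_mass (s : bool) : R :=
  2^-1 * (s == false)%:R + 2^-1 * (s == true)%:R.

Definition mu_prod x : R := \prod_i mu_mass (x i).

Definition hamiltonian beta h x : R :=
  beta / 3 * (\sum_i \sum_j \sum_k A i j k * (x i)%:R * (x j)%:R * (x k)%:R)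
  + h * \sum_i (x i)%:R.

Definition partition_function beta h : R :=
  \sum_(x : config N) expR (hamiltonian beta h x) * mu_prod x.

Definition gibbs_density beta h x : R :=
  (partition_function beta h)^-1 * expR (hamiltonian beta h x).

Definition gibbs beta h (E : set (config N)) : R :=
  \sum_(x in E) gibbs_density beta h x * mu_prod x.

Definition local_field x (i : 'I_N) : R :=
  \sum_j \sum_k A i j k * (x j)%:R * (x k)%:R.

Definition mean_field x : R := N%:R^-1 * \sum_i local_field x i.

Definition T_stat x : R :=
  N%:R^-1 * \sum_i (local_field x i - mean_field x) ^+ 2.

Definition Lambda (t : R) : R := ln ((1 + expR t) / 2).

Definition pl_equations x (p : R * R) : Prop :=
  \sum_i local_field x i *
      ((x i)%:R - (derive1 Lambda) (p.1 * local_field x i + p.2)) = 0 /\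
  \sum_i ((x i)%:R - (derive1 Lambda) (p.1 * local_field x i + p.2)) = 0.

Definition MPLE_exists x : Prop := exists! p : R * R, pl_equations x p.

(* The value (0, 0) is a placeholder used when the MPLE does not exist. *)
Definition MPLE x : R * R :=
  xget (0, 0) [set p | unique (pl_equations x) p]%classic.

End Gibbs.

(* Below, A is a sequence of tensors, and a random variable Y N is a function
   on {0,1}^N, under the Gibbs measure with parameters (beta, h). *)
Section Asymptotics.
Variables (R : realType) (A : forall N, tensor R N) (beta h : R).
Implicit Type Y : forall N, config N -> R.

Definition whp (E : forall N, set (config N)) : Prop :=
  ((fun N => gibbs (@A N) beta h (E N)) @ \oo --> (1 : R))%classic.

Definition whp_not (E : forall N, set (config N)) : Prop :=
  ((fun N => gibbs (@A N) beta h (E N)) @ \oo --> (0 : R))%classic.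

Definition little_op1 Y : Prop :=
  forall e : R, 0 < e -> whp_not (fun N => [set x | e < `|Y N x|]%classic).

Definition Omega_p1 Y : Prop :=
  forall e : nat -> R, (e @ \oo --> (0 : R))%classic ->
    whp_not (fun N => [set x | Y N x <= e N]%classic).

Definition big_Op Y (r : nat -> R) : Prop :=
  forall e : R, 0 < e -> exists2 M : R, 0 < M &
    (\forall N \near \oo,
      gibbs (@A N) beta h [set x | M * r N < `|Y N x|] <= e)%classic.

Definition MPLE_error N (x : config N) : R :=
  Num.max `|(MPLE (@A N) x).1 - beta| `|(MPLE (@A N) x).2 - h|.

Definition jointly_sqrt_consistent : Prop :=
  big_Op MPLE_error (fun N => (Num.sqrt N%:R)^-1).

Definition MPLE_exists_whp : Prop :=
  whp (fun N => [set x | MPLE_exists (@A N) x]%classic).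

End Asymptotics.

(* Main.v *)
Require Import Defs.
From mathcomp Require Import all_boot all_order all_algebra.
From mathcomp Require Import all_classical all_reals all_analysis.
From mathcomp Require Import ring lra zify.
Set Implicit Arguments.
Unset Strict Implicit.
Unset Printing Implicit Defensive.
Import Order.TTheory GRing.Theory Num.Theory.
Import numFieldNormedType.Exports.
Local Open Scope ring_scope.

(** Write [m_i] for the local fields and [b_i = sig (beta m_i + h)] for the
    conditional mean of [x_i] given the other spins.

    Second moment bound: a sum [sum_i g_i(x) (x_i - b_i)], with [g_i] bounded and
    O(1/N)-Lipschitz in each spin, has second moment O(N).  With [g_i = 1] and
    [g_i = m_i] it bounds the score at the true parameter, and strong concavity of
    the pseudo-likelihood where [T_N >= c] then puts the MPLE within O(N^(-1/2)).
    Applied to the quadratic form [sum_i (m_i - sum_jk A_ijk b_j b_k)^2], it shows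
    that the local fields satisfy the mean-field equation up to o(1) in mean square.

    (i)(a) By translation invariance and monotonicity ([beta > 0]) an approximate
    solution lies between the iterates of [t |-> 3 sig (beta t + h)^2] started from
    the two ends; for [h >= 0] both sequences tend to the unique fixed point.

    (i)(b) If [T_N] is small then [m] is nearly its mean, which is at least [3 r^2]
    for a configuration of density [r], so the total weight of such configurations
    is at most the scalar mean-field value.  For [beta] very negative this is beaten
    exponentially by a product measure on the complement of an interval, which has
    fewer progressions than a constant density of the same mass.

    (ii) If [T_N] is small then all [b_i] are nearly some [p] bounded below, hence
    [m_i] is nearly [p^2] times the number of progressions through [i]; but this
    number is not nearly constant on an integer interval. *)

(** * The logistic function *)

Section Sigmoid.
Variable R : realType.
Implicit Types a b c t K : R.

Definition sig t : R := expR t / (1 + expR t).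

Lemma expR1_gt0 t : 0 < 1 + expR t.
Proof. by rewrite addr_gt0 ?expR_gt0. Qed.

Lemma sig_gt0 t : 0 < sig t.
Proof. by rewrite divr_gt0 ?expR_gt0 ?expR1_gt0. Qed.

Lemma sig_lt1 t : sig t < 1.
Proof. by rewrite ltr_pdivrMr ?expR1_gt0// mul1r ltrDr. Qed.

Lemma sig_ge0 t : 0 <= sig t. Proof. exact/ltW/sig_gt0. Qed.
Lemma sig_le1 t : sig t <= 1. Proof. exact/ltW/sig_lt1. Qed.

Lemma sigB a b :
  sig b - sig a = (expR b - expR a) / ((1 + expR a) * (1 + expR b)).
Proof.
rewrite /sig; have := expR1_gt0 a; have := expR1_gt0 b => hb ha.
by field; rewrite !lt0r_neq0.
Qed.

Lemma sig_homo a b : a <= b -> sig a <= sig b.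
Proof.
move=> ab; rewrite -subr_ge0 sigB divr_ge0 ?mulr_ge0 ?(ltW (expR1_gt0 _))//.
by rewrite subr_ge0 ler_expR.
Qed.

(** Convexity: the exponential lies above its tangent at [a]. *)
Lemma expR_diff_ge a b : expR a * (b - a) <= expR b - expR a.
Proof.
have -> : expR b = expR a * expR (b - a) by rewrite -expRD addrC subrK.
have := expR_ge1Dx (b - a); have := expR_gt0 a => h1 h2.
rewrite -[X in _ <= _ - X]mulr1 -mulrBr ler_pM2l//; lra.
Qed.

Lemma sig_lip_le a b : a <= b -> sig b - sig a <= b - a.
Proof.
move=> ab; rewrite sigB ler_pdivrMr ?mulr_gt0 ?expR1_gt0//.
have h := expR_diff_ge b a.
(* The tangent bound at [b] handles the first summand; the remainder is nonnegative. *)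
have -> : (b - a) * ((1 + expR a) * (1 + expR b)) =
  expR b * (b - a) + (b - a) * (1 + expR a + expR a * expR b) by ring.
have : 0 <= (b - a) * (1 + expR a + expR a * expR b).
  by rewrite mulr_ge0 ?subr_ge0// !addr_ge0 ?mulr_ge0 ?expR_ge0.
lra.
Qed.

Lemma sig_lip a b : `|sig a - sig b| <= `|a - b|.
Proof.
wlog ab : a b / a <= b.
  move=> H; case: (leP a b) => [/H//|/ltW/H].
  by rewrite distrC (distrC b).
rewrite distrC (distrC a) !ger0_norm ?subr_ge0 ?sig_homo//.
exact: sig_lip_le.
Qed.

Lemma sig_lip_pos a b : sig b <= sig a + Num.max 0 (b - a).
Proof.
case: (leP a b) => ab.
  by rewrite max_r ?subr_ge0// -lerBlDl sig_lip_le.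
by rewrite (le_trans (sig_homo (ltW ab)))// lerDl le_max lexx.
Qed.

(** A lower bound for the derivative [e^t / (1 + e^t)^2] of [sig] on [[-K, K]]. *)
Definition sig_modulus K : R := expR (- K) / (1 + expR K) ^+ 2.

Lemma sig_modulus_gt0 K : 0 < sig_modulus K.
Proof. by rewrite divr_gt0 ?expR_gt0// exprn_gt0// expR1_gt0. Qed.

(** For [a <= b] the numerator in [sigB] is at least [e^-K (b - a)] and the denominator at most
    [(1 + e^K)^2]. This is the source of strong concavity of the pseudo-likelihood. *)
Lemma sig_strong K a b : `|a| <= K -> `|b| <= K ->
  sig_modulus K * (b - a) ^+ 2 <= (sig b - sig a) * (b - a).
Proof.
wlog ab : a b / a <= b.
  move=> H aK bK; case: (leP a b) => [/H|/ltW/H]; first exact.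
  move=> /(_ bK aK).
  have -> : (a - b) ^+ 2 = (b - a) ^+ 2 by ring.
  by have -> : (sig a - sig b) * (a - b) = (sig b - sig a) * (b - a) by ring.
move=> aK bK; rewrite expr2 mulrA ler_wpM2r ?subr_ge0// sigB /sig_modulus.
move: aK bK; rewrite !ler_norml => /andP[a1 a2] /andP[b1 b2].
rewrite mulrAC ler_pM//.
- by rewrite mulr_ge0 ?expR_ge0 ?subr_ge0.
- apply: le_trans (expR_diff_ge _ _).
  by rewrite ler_wpM2r ?subr_ge0// ler_expR.
- rewrite lef_pV2 ?posrE ?exprn_gt0 ?mulr_gt0 ?expR1_gt0//.
  by rewrite expr2 ler_pM ?(ltW (expR1_gt0 _))// lerD2l ler_expR.
Qed.

Lemma is_derive_Lambda t : is_derive t 1 (@Lambda R) (sig t).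
Proof.
have h : 0 < (1 + expR t) / 2 by rewrite divr_gt0 ?expR1_gt0.
have Hd : is_derive t 1 (fun u : R => (1 + expR u) / 2) (expR t / 2).
  have -> : (fun u : R => (1 + expR u) / 2) = (fun u : R => 2^-1 *: (1 + expR u)).
    by apply/funext => u; rewrite mulrC.
  by apply: is_derive_eq; rewrite add0r mul1r [LHS]mulrC.
have Hl : is_derive ((1 + expR t) / 2) 1 (@ln R) ((1 + expR t) / 2)^-1.
  exact: is_derive1_ln.
rewrite /Lambda.
have := @is_derive1_comp R (@ln R) (fun u : R => (1 + expR u) / 2) t _ _ Hl Hd.
rewrite /comp => H; apply: is_derive_eq.
rewrite /sig invf_div; field.
by rewrite lt0r_neq0 ?expR1_gt0.
Qed.

Lemma derive1_Lambda : derive1 (@Lambda R) = sig.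
Proof.
apply/funext => t; have h := is_derive_Lambda t.
by rewrite derive1E derive_val.
Qed.

(* The weighted AM-GM inequality [1 - s + s e^u >= e^(s u)] at [s = sig c]. *)
Lemma Lambda_tangent b c : Lambda c + sig c * (b - c) <= Lambda b.
Proof.
rewrite /Lambda -[X in _ + X]expRK -lnM ?posrE ?divr_gt0 ?expR1_gt0 ?expR_gt0//.
rewrite ler_ln ?posrE ?mulr_gt0 ?divr_gt0 ?invr_gt0 ?expR1_gt0 ?expR_gt0//.
rewrite mulrAC ler_pM2r ?invr_gt0//.
set s := sig c; set u := b - c.
have hs : (1 + expR c) * s = expR c by rewrite mulrC divfK ?lt0r_neq0 ?expR1_gt0.
have eb : expR b = expR c * expR u by rewrite -expRD /u addrC subrK.
have e1 := expR_ge1Dx (- (s * u)); have e2 := expR_ge1Dx (u - s * u).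
have s0 := sig_ge0 c; have s1 := sig_le1 c; rewrite -/s in s0 s1.
(* Each exponential is at least 1 plus its exponent, and the weighted exponents cancel. *)
have H : 1 <= (1 - s) * expR (- (s * u)) + s * expR (u - s * u).
  have h1 : (1 - s) * (1 - s * u) <= (1 - s) * expR (- (s * u)).
    by rewrite ler_wpM2l ?subr_ge0.
  have h2 : s * (1 + (u - s * u)) <= s * expR (u - s * u).
    by rewrite ler_wpM2l.
  have : (1 - s) * (1 - s * u) + s * (1 + (u - s * u)) = 1 by ring.
  lra.
have -> : 1 + expR b =
  (1 + expR c) * (((1 - s) * expR (- (s * u)) + s * expR (u - s * u)) * expR (s * u)).
  have h3 : expR (- (s * u)) * expR (s * u) = 1 by rewrite -expRD addNr expR0.
  have h4 : expR (u - s * u) * expR (s * u) = expR u by rewrite -expRD subrK.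
  transitivity ((1 + expR c) * ((1 - s) * (expR (- (s * u)) * expR (s * u)) +
    s * (expR (u - s * u) * expR (s * u)))); last by ring.
  by rewrite h3 h4 mulr1 mulrDr mulrBr mulr1 hs mulrA hs -eb; ring.
rewrite ler_pM2l ?expR1_gt0// ler_peMl ?expR_ge0//.
Qed.

End Sigmoid.

(** * Gibbs measures of regular tensors *)

(** What the two progression tensors have in common. The bound [D / N] on pair sums makes the
    influence of one spin on a local field O(1/N); the zero diagonal keeps a spin out of its own
    field. *)
Record regular (R : realType) (D : R) N (A : tensor R N) : Prop := Regular {
  tensorC12 : forall i j k, A i j k = A j i k;
  tensorC23 : forall i j k, A i j k = A i k j;
  tensor_diag : forall i k, A i i k = 0;
  tensor_ge0 : forall i j k, 0 <= A i j k;
  tensor_sum : forall i j, \sum_k A i j k <= D / N%:R }.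

(** * Bilinear and trilinear forms of a regular tensor *)

Section Multilinear.
Variables (R : realType) (N : nat) (A : tensor R N).
Implicit Types u v w : 'I_N -> R.

(** Local fields extended to real weights, so that spins can be replaced by their conditional
    means. *)
Definition bil v w (i : 'I_N) : R := \sum_j \sum_k A i j k * v j * w k.
Definition tri u v w : R := \sum_i \sum_j \sum_k A i j k * u i * v j * w k.

Lemma triE u v w : tri u v w = \sum_i u i * bil v w i.
Proof.
apply: eq_bigr => i _; rewrite /bil mulr_sumr; apply: eq_bigr => j _.
by rewrite mulr_sumr; apply: eq_bigr => k _; ring.
Qed.

Lemma eq_bil v v' w w' : v =1 v' -> w =1 w' -> bil v w =1 bil v' w'.
Proof.
by move=> vv ww i; apply: eq_bigr => j _; apply: eq_bigr => k _; rewrite vv ww.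
Qed.

Lemma eq_tri u u' v v' w w' :
  u =1 u' -> v =1 v' -> w =1 w' -> tri u v w = tri u' v' w'.
Proof.
move=> uu vv ww; rewrite !triE; apply: eq_bigr => i _.
by rewrite uu (eq_bil vv ww).
Qed.

Lemma bilDl v v' w i :
  bil (fun j => v j + v' j) w i = bil v w i + bil v' w i.
Proof.
rewrite /bil -big_split/=; apply: eq_bigr => j _.
by rewrite -big_split/=; apply: eq_bigr => k _; ring.
Qed.

Variables (D : R) (hA : regular D A).

Lemma bilC v w i : bil v w i = bil w v i.
Proof.
rewrite /bil exchange_big; apply: eq_bigr => j _; apply: eq_bigr => k _.
by rewrite (tensorC23 hA); ring.
Qed.

(** Difference of squares, by symmetry of the tensor. Later comparisons of local fields go through
    it: for weights in [[0, 1]] the factor [v + u] is at most 2. *)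
Lemma bil_sqB v u i : bil v v i - bil u u i =
  bil (fun j => v j - u j) (fun j => v j + u j) i.
Proof.
rewrite bilDl (bilC v) bilDl.
have -> : bil (fun j => - u j) (fun j => v j + u j) i =
  - bil u v i - bil u u i.
  rewrite bilC bilDl (bilC v) (bilC u (fun=> _)) /bil -!sumrN -!big_split/=.
  apply: eq_bigr => j _; rewrite -!sumrN -!big_split/=.
  by apply: eq_bigr => k _; ring.
ring.
Qed.

Lemma triC12 u v w : tri u v w = tri v u w.
Proof.
rewrite /tri exchange_big; apply: eq_bigr => j _; apply: eq_bigr => k _.
by apply: eq_bigr => l _; rewrite (tensorC12 hA); ring.
Qed.

Lemma triC23 u v w : tri u v w = tri u w v.
Proof. by rewrite !triE; apply: eq_bigr => i _; rewrite bilC. Qed.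

Lemma triDl u u' v w :
  tri (fun j => u j + u' j) v w = tri u v w + tri u' v w.
Proof.
by rewrite !triE -big_split; apply: eq_bigr => i _; rewrite mulrDl.
Qed.

Definition unit_at (i j : 'I_N) : R := (j == i)%:R.

Lemma sum_unit_at i v : \sum_j unit_at i j * v j = v i.
Proof.
rewrite (bigD1 i)//= /unit_at eqxx mul1r big1 ?addr0// => j /negPf ->.
by rewrite mul0r.
Qed.

Lemma tri_unit_at i v w : tri (unit_at i) v w = bil v w i.
Proof. by rewrite triE sum_unit_at. Qed.

Lemma bil_unit_at i w : bil (unit_at i) w i = 0.
Proof.
rewrite /bil (bigD1 i)//= [X in _ + X]big1 ?addr0 => [|j /negPf ji].
  by rewrite big1// => k _; rewrite (tensor_diag hA) !mul0r.
by rewrite big1// => k _; rewrite /unit_at ji mulr0 mul0r.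
Qed.

(** Terms with [unit_at i] in two or three slots vanish by the zero diagonal, and the three with a
    single one agree by symmetry. The factor 3 cancels the one in [beta / 3]. *)
Lemma tri_cube u i :
  tri (fun j => u j + unit_at i j) (fun j => u j + unit_at i j)
      (fun j => u j + unit_at i j)
  = tri u u u + 3 * bil u u i.
Proof.
set v := fun j => _.
have E w1 w2 : tri v w1 w2 = tri u w1 w2 + bil w1 w2 i.
  by rewrite /v triDl tri_unit_at.
have Ebil w : bil v w i = bil u w i by rewrite /v bilDl bil_unit_at addr0.
rewrite E (triC12 u v v) E (triC23 u u v) (triC12 u v u) E.
by rewrite (bilC u v) !Ebil (bilC u v) Ebil; ring.
Qed.

Lemma tensor_sum2 i : \sum_j \sum_k A i j k <= D.
Proof.
have N0 : (0 < N)%N by case: (N) i => [[]|].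
apply: (@le_trans _ _ (\sum_(j < N) D / N%:R)).
  by apply: ler_sum => j _; exact: (tensor_sum hA).
rewrite sumr_const card_ord -[X in X <= _]mulr_natr divfK//.
by rewrite pnatr_eq0 -lt0n.
Qed.

Lemma bil_ge0 v w i : (forall j, 0 <= v j) -> (forall j, 0 <= w j) ->
  0 <= bil v w i.
Proof.
move=> v0 w0; apply: sumr_ge0 => j _; apply: sumr_ge0 => k _.
by rewrite !mulr_ge0// (tensor_ge0 hA).
Qed.

Lemma bil_le v v' w w' i : (forall j, 0 <= v j <= v' j) ->
  (forall j, 0 <= w j <= w' j) -> bil v w i <= bil v' w' i.
Proof.
move=> hv hw; apply: ler_sum => j _; apply: ler_sum => k _.
have /andP[v0 v1] := hv j; have /andP[w0 w1] := hw k.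
by rewrite -!mulrA ler_wpM2l ?(tensor_ge0 hA)// ler_pM.
Qed.

Lemma bil1_le i : bil (fun=> 1) (fun=> 1) i <= D.
Proof.
apply: le_trans (tensor_sum2 i).
by apply: ler_sum => j _; apply: ler_sum => k _; rewrite !mulr1.
Qed.

Lemma regular_ge0 : 'I_N -> 0 <= D.
Proof.
move=> i; apply: le_trans (tensor_sum2 i).
by apply: sumr_ge0 => j _; apply: sumr_ge0 => k _; exact: (tensor_ge0 hA).
Qed.

Lemma bil_le1 v w i : (forall j, 0 <= v j <= 1) -> (forall j, 0 <= w j <= 1) ->
  bil v w i <= D.
Proof. by move=> hv hw; apply: le_trans (bil1_le i); exact: bil_le. Qed.

Lemma bil1 v i : bil v (fun=> 1) i <= D / N%:R * \sum_j `|v j|.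
Proof.
rewrite mulr_sumr; apply: ler_sum => j _.
have -> : \sum_k A i j k * v j * 1 = (\sum_k A i j k) * v j.
  by rewrite mulr_suml; apply: eq_bigr => k _; rewrite mulr1.
have s0 : 0 <= \sum_k A i j k by apply: sumr_ge0 => k _; exact: (tensor_ge0 hA).
apply: (@le_trans _ _ ((\sum_k A i j k) * `|v j|)).
  by rewrite ler_wpM2l// ler_norm.
by rewrite ler_wpM2r// (tensor_sum hA).
Qed.

Lemma bil_bound c v w i : (forall j k, `|v j * w k| <= c) -> `|bil v w i| <= D * c.
Proof.
move=> H; have c0 : 0 <= c := le_trans (normr_ge0 _) (H i i).
apply: (@le_trans _ _ (\sum_j \sum_k A i j k * c)).
  apply: (le_trans (ler_norm_sum _ _ _)); apply: ler_sum => j _.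
  apply: (le_trans (ler_norm_sum _ _ _)); apply: ler_sum => k _.
  by rewrite -mulrA normrM ger0_norm ?(tensor_ge0 hA)// ler_wpM2l ?(tensor_ge0 hA).
apply: (@le_trans _ _ ((\sum_j \sum_k A i j k) * c)).
  by rewrite mulr_suml; apply: ler_sum => j _; rewrite mulr_suml.
by rewrite ler_wpM2r// tensor_sum2.
Qed.

End Multilinear.

(** * Conditional laws and influences of single spins *)

Section Gibbs.
Variables (R : realType) (N : nat) (A : tensor R N) (D : R).
Hypothesis hA : regular D A.
Variables (beta h : R).
Implicit Types (x : config N) (i j k l : 'I_N) (f g : config N -> R).

Definition ind x i : R := (x i)%:R.

Lemma ind01 x i : 0 <= ind x i <= 1.
Proof. by rewrite /ind; case: (x i); rewrite ?ler01 ?lexx. Qed.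

Lemma local_fieldE x i : local_field A x i = bil A (ind x) (ind x) i.
Proof. by []. Qed.

Lemma hamiltonianE x : hamiltonian A beta h x =
  beta / 3 * tri A (ind x) (ind x) (ind x) + h * \sum_i ind x i.
Proof. by []. Qed.

Definition setc i s x : config N := [ffun j => if j == i then s else x j].
Definition zap i x := setc i false x.

Lemma setcE i s x j : setc i s x j = if j == i then s else x j.
Proof. by rewrite ffunE. Qed.

Lemma setc_id i x : setc i (x i) x = x.
Proof. by apply/ffunP => j; rewrite setcE; case: eqP => // ->. Qed.

Lemma setcK i s s' x : setc i s (setc i s' x) = setc i s x.
Proof. by apply/ffunP => j; rewrite !setcE; case: eqP. Qed.

Lemma ind_setc_true i x j : ind (setc i true x) j = ind (zap i x) j + unit_at R i j.
Proof.
rewrite /ind /zap /unit_at !setcE; case: eqP => _ /=; by rewrite ?add0r ?addr0.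
Qed.

Lemma local_field_setc i s x : local_field A (setc i s x) i = local_field A x i.
Proof.
suff E t y : local_field A (setc i t y) i = local_field A (zap i y) i.
  by rewrite E -{2}(setc_id i x) E.
case: t => //; rewrite !local_fieldE.
have H := ind_setc_true i y.
rewrite (eq_bil _ H H) bilDl (bil_unit_at hA) addr0.
by rewrite (bilC hA) bilDl (bil_unit_at hA) addr0.
Qed.

(** Identifies [beta * m_i + h] as the conditional log-odds of the spin at [i]. *)
Lemma hamiltonian_setc i x :
  hamiltonian A beta h (setc i true x) =
  hamiltonian A beta h (zap i x) + (beta * local_field A x i + h).
Proof.
rewrite !hamiltonianE; have H := ind_setc_true i x.
rewrite (eq_tri _ H H H) (tri_cube hA) (eq_bigr _ (fun j _ => H j)) big_split/=.
have -> : \sum_j unit_at R i j = 1.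
  rewrite -[RHS](sum_unit_at i (fun=> 1)); apply: eq_bigr => j _.
  by rewrite mulr1.
by rewrite -local_fieldE local_field_setc; field.
Qed.

Definition pmass x : R := gibbs_density A beta h x * mu_prod R x.

Lemma mu_prodE x : mu_prod R x = 2^-1 ^+ N.
Proof.
rewrite /mu_prod (eq_bigr (fun=> 2^-1)) => [|i _].
  by rewrite prodr_const card_ord.
by rewrite /mu_mass; case: (x i) => /=; rewrite ?mulr1 ?mulr0 ?add0r ?addr0.
Qed.

Lemma mu_prod_gt0 x : 0 < mu_prod R x.
Proof. by rewrite mu_prodE exprn_gt0// invr_gt0. Qed.

Lemma partition_function_gt0 : 0 < partition_function A beta h.
Proof.
rewrite /partition_function (bigD1 [ffun=> false])//=.
rewrite ltr_wpDr ?mulr_gt0 ?expR_gt0 ?mu_prod_gt0//.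
by apply: sumr_ge0 => x _; rewrite mulr_ge0 ?expR_ge0 ?(ltW (mu_prod_gt0 _)).
Qed.

Lemma pmass_gt0 x : 0 < pmass x.
Proof.
by rewrite !mulr_gt0 ?invr_gt0 ?partition_function_gt0 ?expR_gt0 ?mu_prod_gt0.
Qed.

Lemma pmass_sum1 : \sum_x pmass x = 1.
Proof.
rewrite (eq_bigr (fun x => (partition_function A beta h)^-1 *
  (expR (hamiltonian A beta h x) * mu_prod R x))) => [|x _]; last first.
  by rewrite mulrA.
by rewrite -mulr_sumr mulVf// lt0r_neq0// partition_function_gt0.
Qed.

Lemma pmass_setc i x :
  pmass (setc i true x) = pmass (zap i x) * expR (beta * local_field A x i + h).
Proof.
rewrite /pmass /gibbs_density hamiltonian_setc expRD !mu_prodE; ring.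
Qed.

Definition expect f : R := \sum_x pmass x * f x.

Lemma expectD f g : expect (fun x => f x + g x) = expect f + expect g.
Proof. by rewrite /expect -big_split; apply: eq_bigr => x _; rewrite mulrDr. Qed.

Lemma eq_expect f g : f =1 g -> expect f = expect g.
Proof. by move=> fg; apply: eq_bigr => x _; rewrite fg. Qed.

Lemma expect_sum (F : 'I_N -> config N -> R) :
  expect (fun x => \sum_i F i x) = \sum_i expect (F i).
Proof.
rewrite /expect exchange_big; apply: eq_bigr => x _; by rewrite mulr_sumr.
Qed.

Lemma expect_le f g : (forall x, f x <= g x) -> expect f <= expect g.
Proof. by move=> fg; apply: ler_sum => x _; rewrite ler_pM2l ?pmass_gt0. Qed.

Lemma expect_cst c : expect (fun=> c) = c.
Proof. by rewrite /expect -mulr_suml pmass_sum1 mul1r. Qed.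

Lemma gibbsE (E : set (config N)) :
  gibbs A beta h E = expect (fun x => (x \in E)%:R).
Proof.
rewrite /gibbs big_mkcond; apply: eq_bigr => x _.
by case: (x \in E); rewrite ?mulr1 ?mulr0.
Qed.

Lemma gibbs_ge0 E : 0 <= gibbs A beta h E.
Proof.
by rewrite gibbsE; apply: sumr_ge0 => x _; rewrite mulr_ge0// ltW// pmass_gt0.
Qed.

Lemma gibbs_sub (E F : set (config N)) : (E `<=` F)%classic ->
  gibbs A beta h E <= gibbs A beta h F.
Proof.
move=> EF; rewrite !gibbsE; apply: expect_le => x.
case: (boolP (x \in E)) => // /set_mem/EF xF.
by rewrite (mem_set xF).
Qed.

Lemma gibbsU (E F : set (config N)) :
  gibbs A beta h (E `|` F)%classic <= gibbs A beta h E + gibbs A beta h F.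
Proof.
rewrite !gibbsE -expectD; apply: expect_le => x; rewrite in_setU.
by do 2 case: (_ \in _); rewrite /= ?addr0 ?add0r// lerDl.
Qed.

Lemma gibbsC (E : set (config N)) :
  gibbs A beta h (~` E)%classic = 1 - gibbs A beta h E.
Proof.
apply/eqP; rewrite eq_sym subr_eq eq_sym addrC; apply/eqP.
rewrite !gibbsE -expectD -[RHS](expect_cst 1); apply: eq_expect => x.
by rewrite in_setC; case: (x \in E); rewrite /= ?addr0 ?add0r.
Qed.

Lemma gibbs_markov (E : set (config N)) f : (forall x, 0 <= f x) ->
  (forall x, E x -> 1 <= f x) -> gibbs A beta h E <= expect f.
Proof.
move=> f0 f1; rewrite gibbsE; apply: expect_le => x.
by case: (boolP (x \in E)) => [/set_mem/f1|].
Qed.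

Definition cmean x i : R := sig (beta * local_field A x i + h).

Lemma cmean01 x i : 0 <= cmean x i <= 1.
Proof. by rewrite sig_ge0 sig_le1. Qed.

(* Pairing [x] with its flip at [i], the two terms cancel, since the
   conditional odds of [x i = 1] are [expR (beta * m_i + h)]. *)
Lemma expect_centered i g : (forall s x, g (setc i s x) = g x) ->
  expect (fun x => g x * (ind x i - cmean x i)) = 0.
Proof.
move=> gi; set F := fun x => pmass x * (g x * (ind x i - cmean x i)).
pose flip x := setc i (~~ x i) x.
have flipK : involutive flip.
  by move=> x; rewrite /flip setcK setcE eqxx negbK setc_id.
have H x : F (setc i true x) + F (zap i x) = 0.
  rewrite /F !gi pmass_setc /cmean /zap !local_field_setc /ind !setcE eqxx/=.
  rewrite /sig; field; exact/lt0r_neq0/expR1_gt0.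
have E : expect (fun x => g x * (ind x i - cmean x i)) = \sum_x F (flip x).
  by rewrite /expect [LHS](reindex_inj (inv_inj flipK)).
have : \sum_x F x + \sum_x F (flip x) = 0.
  rewrite -big_split/= big1// => x _; rewrite /flip.
  have Ex := setc_id i x; have := H x; rewrite /zap.
  by case xi : (x i) Ex => /= ->; rewrite // addrC.
by rewrite -E /expect -/F => ?; lra.
Qed.

(** Influence is measured by zeroing a spin, which is how the second moment argument removes the
    dependence on it. *)
Definition lip K f := forall x l, `|f x - f (zap l x)| <= K / N%:R.

Let N_gt0 : 'I_N -> 0 < N%:R :> R.
Proof. by move=> i; rewrite ltr0n; case: (N) i => [[]|]. Qed.

Lemma lip_ge0 K f : 'I_N -> lip K f -> 0 <= K.
Proof.
move=> l Kf; have := le_trans (normr_ge0 _) (Kf [ffun=> true] l).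
by rewrite pmulr_lge0// invr_gt0 N_gt0.
Qed.

Lemma lip_cst c : lip 0 (fun=> c).
Proof. by move=> x l; rewrite subrr normr0 mul0r. Qed.

Lemma lipB K K' f g : lip K f -> lip K' g -> lip (K + K') (fun x => f x - g x).
Proof.
move=> Kf Kg x l; rewrite mulrDl.
have -> : f x - g x - (f (zap l x) - g (zap l x)) =
  (f x - f (zap l x)) - (g x - g (zap l x)) by ring.
by rewrite (le_trans (ler_normB _ _))// lerD.
Qed.

Lemma norm_mulB (B B' a b c d : R) : `|a| <= B -> `|d| <= B' ->
  `|a * b - c * d| <= B * `|b - d| + B' * `|a - c|.
Proof.
move=> aB dB; have -> : a * b - c * d = a * (b - d) + (a - c) * d by ring.
rewrite (le_trans (ler_normD _ _))// !normrM lerD//.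
  by rewrite ler_wpM2r.
by rewrite mulrC ler_wpM2r.
Qed.

Lemma local_field01 x i : 0 <= local_field A x i <= D.
Proof.
have H j := andP (ind01 x j).
rewrite local_fieldE (bil_ge0 hA)/= => [|j|j]; try by case: (H j).
by apply: (bil_le1 hA) => j; exact: ind01.
Qed.

(** In [bil_sqB] the difference of the two configurations is carried by [l], their sum is at most 2,
    and one pair sum is at most [D / N]. *)
Lemma lip_local_field j : lip (2 * D) (fun x => local_field A x j).
Proof.
move=> x l; have D0 := regular_ge0 hA j.
rewrite !local_fieldE (bil_sqB hA).
have H k : 0 <= ind x k - ind (zap l x) k <= unit_at R l k.
  rewrite /ind /zap setcE /unit_at; case: eqP => _; case: (x k) => /=; lra.
have H2 k : 0 <= ind x k + ind (zap l x) k <= 2.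
  by have := ind01 x k; have := ind01 (zap l x) k; lra.
rewrite ger0_norm; last first.
  by apply: (bil_ge0 hA) => k; [have := H k | have := H2 k]; lra.
apply: (le_trans (bil_le hA j H H2)).
have -> : bil A (unit_at R l) (fun=> 2) j = 2 * bil A (unit_at R l) (fun=> 1) j.
  rewrite /bil mulr_sumr; apply: eq_bigr => k _; rewrite mulr_sumr.
  by apply: eq_bigr => m _; ring.
rewrite -mulrA ler_pM2l//; apply: (le_trans (bil1 hA _ _)).
rewrite (eq_bigr (fun k => unit_at R l k * 1)) ?sum_unit_at ?mulr1// => k _.
by rewrite mulr1 ger0_norm// /unit_at ler0n.
Qed.

End Gibbs.

(** * The second moment bound *)

Section SecondMoment.
Variables (R : realType) (N : nat) (A : tensor R N) (D : R).
Hypothesis hA : regular D A.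
Variables (beta h : R).
Implicit Types (x : config N) (i j k l : 'I_N).

Let Kb := `|beta| * (2 * D).

Lemma lip_cmean j : lip Kb (fun x => cmean A beta h x j).
Proof.
move=> x l; rewrite /cmean (le_trans (sig_lip _ _))//.
rewrite opprD addrACA subrr addr0 -mulrBr normrM /Kb -mulrA ler_wpM2l//.
exact: lip_local_field.
Qed.

Section Bounded.
Variables (g : 'I_N -> config N -> R) (B K : R).
Hypothesis gB : forall i x, `|g i x| <= B.
Hypothesis gK : forall i, lip K (g i).

Let F i x := g i x * (ind R x i - cmean A beta h x i).
Let S x := \sum_i F i x.

Lemma norm_ind_cmean x y i : `|ind R x i - cmean A beta h y i| <= 1.
Proof.
have := ind01 R x i; have := cmean01 A beta h y i.
by rewrite ler_norml => /andP[? ?] /andP[? ?]; apply/andP; split; lra.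
Qed.

Let N_gt0 : 'I_N -> 0 < N%:R :> R.
Proof. by move=> i; rewrite ltr0n; case: (N) i => [[]|]. Qed.

Let FB i x : `|F i x| <= B.
Proof.
rewrite normrM -[B]mulr1 ler_pM// norm_ind_cmean//.
Qed.

Let S_le x : `|S x| <= B * N%:R.
Proof.
rewrite (le_trans (ler_norm_sum _ _ _))//.
rewrite (le_trans (ler_sum _ (fun i _ => FB i x)))//.
by rewrite sumr_const card_ord mulr_natr.
Qed.

Let B_ge0 : 'I_N -> 0 <= B.
Proof. by move=> i; apply: le_trans (gB i [ffun=> true]). Qed.

Let C1 := K + B + B * Kb.

(** The term of site [i] itself changes by at most [B] through its spin; every term also moves by
    O(1/N) through [g] and [cmean], and there are [N] of them. *)
Let S_lip x i : `|S x - S (zap i x)| <= C1.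
Proof.
rewrite /S -sumrB (le_trans (ler_norm_sum _ _ _))//.
have N0 := N_gt0 i; have B0 := B_ge0 i.
apply: (@le_trans _ _ (\sum_j (B * unit_at R i j + (K + B * Kb) / N%:R))).
  apply: ler_sum => j _; rewrite /F.
  apply: (le_trans (norm_mulB _ _ (gB j x) (norm_ind_cmean (zap i x) (zap i x) j))).
  rewrite mul1r [(K + _) / _]mulrDl addrCA [leLHS]addrC lerD ?gK//.
  rewrite -mulrA -mulrDr ler_wpM2l//.
  have -> : ind R x j - cmean A beta h x j -
    (ind R (zap i x) j - cmean A beta h (zap i x) j) =
    (ind R x j - ind R (zap i x) j) -
    (cmean A beta h x j - cmean A beta h (zap i x) j) by ring.
  rewrite (le_trans (ler_normB _ _))// lerD ?lip_cmean//.
  rewrite /ind /zap setcE /unit_at; case: (j == i); case: (x j) => /=;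
  by rewrite ?subrr ?normr0 ?subr0 ?normr1.
rewrite big_split/= -mulr_sumr sumr_const card_ord.
have -> : \sum_j unit_at R i j = 1.
  rewrite -[RHS](sum_unit_at i (fun=> 1)); apply: eq_bigr => j _.
  by rewrite mulr1.
rewrite -[X in _ + X]mulr_natr divfK ?lt0r_neq0// /C1; lra.
Qed.

Let C := K * B + B * C1.

(* [F i * S] differs by O(1) from the product in which [g i] and [S] are
   replaced by their values at [x i := 0]; the latter is centered. *)
Let FS_le i : expect A beta h (fun x => F i x * S x) <= C.
Proof.
set G := fun x => (g i (zap i x) * S (zap i x)) * (ind R x i - cmean A beta h x i).
have G0 : expect A beta h G = 0.
  by apply: (expect_centered hA) => s x; rewrite /zap !setcK.
have N0 := N_gt0 i; have B0 := B_ge0 i.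
have K0 : 0 <= K := lip_ge0 i (gK i).
have -> : expect A beta h (fun x => F i x * S x) =
  expect A beta h (fun x => F i x * S x - G x).
  have E : (fun x => F i x * S x) =1 (fun x => (F i x * S x - G x) + G x).
    by move=> x; rewrite subrK.
  by rewrite (eq_expect _ _ _ E) expectD G0 addr0.
rewrite -(expect_cst A beta h C); apply: expect_le => // x.
rewrite (le_trans (ler_norm _))//.
have -> : F i x * S x - G x = (ind R x i - cmean A beta h x i) *
  (S x * g i x - S (zap i x) * g i (zap i x)) by rewrite /F /G; ring.
rewrite normrM -[C]mul1r ler_pM ?norm_ind_cmean//.
apply: (le_trans (norm_mulB _ _ (S_le x) (gB i (zap i x)))).
rewrite /C lerD ?ler_wpM2l// -mulrA [leRHS]mulrC ler_wpM2l// mulrC.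
by rewrite -ler_pdivlMr// gK.
Qed.

(** Expand one factor of the square: each of the [N] expectations of [F i * S] is at most [C] by
    [FS_le]. *)
Lemma second_moment : expect A beta h (fun x => S x ^+ 2) <=
  (K * B + B * (K + B + B * Kb)) * N%:R.
Proof.
have E : (fun x => S x ^+ 2) =1 (fun x => \sum_i F i x * S x).
  by move=> x; rewrite -mulr_suml expr2.
rewrite (eq_expect _ _ _ E) expect_sum.
rewrite (le_trans (ler_sum _ (fun i _ => FS_le i)))//.
by rewrite sumr_const card_ord mulr_natr.
Qed.

End Bounded.

(** * The approximate mean-field equation *)

Definition fixed_pt_gap x i : R :=
  local_field A x i - bil A (cmean A beta h x) (cmean A beta h x) i.

Lemma norm_gap x i : `|fixed_pt_gap x i| <= D.
Proof.
have := local_field01 hA x i; rewrite /fixed_pt_gap.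
have : 0 <= bil A (cmean A beta h x) (cmean A beta h x) i <= D.
  rewrite (bil_ge0 hA) ?(bil_le1 hA)// => j; try exact: cmean01.
  by case/andP: (cmean01 A beta h x j).
  by case/andP: (cmean01 A beta h x j).
by rewrite ler_norml => /andP[? ?] /andP[? ?]; apply/andP; split; lra.
Qed.

Lemma lip_gap i : lip (2 * D + D * (2 * Kb)) (fun x => fixed_pt_gap x i).
Proof.
apply: lipB; first exact: lip_local_field.
move=> x l; rewrite (bil_sqB hA) -mulrA.
have D0 := regular_ge0 hA i.
apply: (bil_bound hA) => j k; rewrite normrM mulrC -mulrA.
have c1 := cmean01 A beta h x k; have c2 := cmean01 A beta h (zap l x) k.
rewrite ler_pM// ?lip_cmean//.
by rewrite ger0_norm; lra.
Qed.

(** The coefficient of [x_j - b_j] after one factor of each squared gap is expanded by [bil_sqB]; it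
    gives the sum of squared gaps the form treated by [second_moment]. *)
Let g j x := \sum_i \sum_k A i j k * (fixed_pt_gap x i) *
  (ind R x k + cmean A beta h x k).

Let gap_sum x : \sum_i fixed_pt_gap x i ^+ 2 =
  \sum_j g j x * (ind R x j - cmean A beta h x j).
Proof.
have E i : fixed_pt_gap x i ^+ 2 = \sum_j \sum_k A i j k * fixed_pt_gap x i *
    (ind R x k + cmean A beta h x k) * (ind R x j - cmean A beta h x j).
  rewrite expr2 {1}/fixed_pt_gap local_fieldE (bil_sqB hA) /bil mulr_suml.
  apply: eq_bigr => j _; rewrite mulr_suml; apply: eq_bigr => k _; ring.
rewrite (eq_bigr _ (fun i _ => E i)) exchange_big; apply: eq_bigr => j _.
rewrite /g mulr_suml; apply: eq_bigr => i _.
by rewrite mulr_suml.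
Qed.

Let g_bil j x :
  g j x = bil A (fixed_pt_gap x) (fun k => ind R x k + cmean A beta h x k) j.
Proof.
apply: eq_bigr => i _; apply: eq_bigr => k _.
by rewrite (tensorC12 hA).
Qed.

Let gB j x : `|g j x| <= D * (2 * D).
Proof.
rewrite g_bil; apply: (bil_bound hA) => i k.
rewrite normrM mulrC ler_pM ?norm_gap//.
by have := ind01 R x k; have := cmean01 A beta h x k => ? ?; rewrite ger0_norm; lra.
Qed.

(** The three contributions come from the change of the gaps, of the conditional means, and of the
    zeroed spin. *)
Let Kg := D * (2 * (2 * D + D * (2 * Kb)) + D * Kb) + D * D.

Let g_lip j : lip Kg (g j).
Proof.
move=> x l; rewrite !g_bil.
have D0 := regular_ge0 hA j.
have N0 : 0 < N%:R :> R by rewrite ltr0n; case: (N) j => [[]|].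
have Kb0 : 0 <= Kb by rewrite !mulr_ge0.
set w := fun k => ind R (zap l x) k + cmean A beta h x k.
have -> : bil A (fixed_pt_gap x) (fun k => ind R x k + cmean A beta h x k) j =
  bil A (fixed_pt_gap x) w j +
  bil A (fun k => ind R x k - ind R (zap l x) k) (fixed_pt_gap x) j.
  have E : (fun k => ind R x k + cmean A beta h x k) =1
    (fun k => w k + (ind R x k - ind R (zap l x) k)) by move=> k; rewrite /w; ring.
  by rewrite (eq_bil A (frefl (fixed_pt_gap x)) E) (bilC hA) bilDl (bilC hA w).
rewrite addrAC (le_trans (ler_normD _ _))//.
rewrite [Kg / _]mulrDl lerD//.
  have -> : bil A (fixed_pt_gap x) w j - bil A (fixed_pt_gap (zap l x))
     (fun k => ind R (zap l x) k + cmean A beta h (zap l x) k) j =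
    bil A (fun k => fixed_pt_gap x k - fixed_pt_gap (zap l x) k) w j +
    bil A (fixed_pt_gap (zap l x))
      (fun k => cmean A beta h x k - cmean A beta h (zap l x) k) j.
    rewrite bilDl -addrA; congr (_ + _).
    rewrite /bil -!sumrN -!big_split/=.
    apply: eq_bigr => i _; rewrite -!sumrN -!big_split/=.
    by apply: eq_bigr => k _; rewrite /w; ring.
  rewrite -mulrA [(_ + _) / _]mulrDl mulrDr (le_trans (ler_normD _ _))//.
  rewrite lerD//; apply: (bil_bound hA) => i k; rewrite normrM.
    rewrite -mulrA mulrC ler_pM ?lip_gap//.
    have := ind01 R (zap l x) k; have := cmean01 A beta h x k => ? ?.
    by rewrite /w ger0_norm; lra.
  by rewrite -mulrA ler_pM ?norm_gap ?lip_cmean.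
(* The change of the spin at [l] is of order 1 and not O(1/N), so [bil_bound] would be too weak; as
   it is confined to [l], a single pair sum supplies the factor [1 / N]. *)
have -> : bil A (fun k => ind R x k - ind R (zap l x) k) (fixed_pt_gap x) j =
   \sum_k A j l k * (ind R x l * fixed_pt_gap x k).
  rewrite /bil (bigD1 l)//= [X in _ + X]big1 ?addr0 => [|i /negPf il].
    apply: eq_bigr => k _.
    by rewrite /ind /zap setcE eqxx subr0 mulrA.
  by rewrite big1// => k _; rewrite /ind /zap setcE il subrr mulr0 mul0r.
rewrite (le_trans (ler_norm_sum _ _ _))//.
apply: (@le_trans _ _ (\sum_k A j l k * D)).
  apply: ler_sum => k _; rewrite !normrM ger0_norm ?(tensor_ge0 hA)//.
  rewrite ler_wpM2l ?(tensor_ge0 hA)// -[D]mul1r ler_pM ?norm_gap//.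
  by have := ind01 R x l => ?; rewrite ger0_norm; lra.
by rewrite -mulr_suml [leLHS]mulrC -mulrA ler_wpM2l// (tensor_sum hA).
Qed.

Definition gap_cst : R :=
  Kg * (D * (2 * D)) + D * (2 * D) * (Kg + D * (2 * D) + D * (2 * D) * Kb).

(** The sum of squared gaps is thus typically of order at most the square root of [N], hence
    o(N). *)
Lemma expect_gap2 : expect A beta h (fun x => (\sum_i fixed_pt_gap x i ^+ 2) ^+ 2)
  <= gap_cst * N%:R.
Proof.
rewrite (eq_expect _ _ _ (fun x => congr1 (fun y => y ^+ 2) (gap_sum x))).
exact: (second_moment gB g_lip).
Qed.

End SecondMoment.

(** * Pseudo-likelihood *)

Lemma sqrB_le (R : realDomainType) (a b : R) :
  (a - b) ^+ 2 <= 2 * a ^+ 2 + 2 * b ^+ 2.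
Proof. by have := sqr_ge0 (a + b); rewrite sqrrD sqrrB; lra. Qed.

Section PseudoLikelihood.
Local Open Scope classical_set_scope.
Variables (R : realType) (N : nat) (m y : 'I_N -> R).

(** The log pseudo-likelihood up to an additive constant, for fields [m] and responses [y]; its
    gradient is [scores]. *)
Definition plik (p : R * R) : R :=
  \sum_i (y i * (p.1 * m i + p.2) - Lambda (p.1 * m i + p.2)).

Lemma continuous_plik : continuous plik.
Proof.
rewrite /plik; apply: continuous_big => [|i _ p]; first exact: add_continuous.
have H : (fun p : R * R => p.1 * m i + p.2) @ p --> p.1 * m i + p.2.
  apply: cvgD; last exact: cvg_snd.
  by apply: cvgM; [exact: cvg_fst|exact: cvg_cst].
apply: cvgB; first by apply: cvgM => //; exact: cvg_cst.
apply: (@continuous_cvg _ _ _ _ _ _ (@Lambda R)) H.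
apply/differentiable_continuous/derivable1_diffP.
by have [] := is_derive_Lambda (p.1 * m i + p.2).
Qed.

(** The affine form [a i * t + c i] covers both partial derivatives: slope [m i] for the first
    parameter, slope 1 for the second. *)
Lemma is_derive_plik (a c : 'I_N -> R) (t : R) :
  is_derive t 1 (fun t => \sum_i (y i * (a i * t + c i) - Lambda (a i * t + c i)))
   (\sum_i a i * (y i - sig (a i * t + c i))).
Proof.
have H i : is_derive t 1 (fun t => y i * (a i * t + c i) - Lambda (a i * t + c i))
   (a i * (y i - sig (a i * t + c i))).
  have H1 : is_derive t 1 (fun t : R => a i * t + c i) (a i).
    by apply: is_derive_eq; rewrite addr0 [LHS]mulr1.
  have H2 := is_derive_Lambda (a i * t + c i).
  have H3 := @is_derive1_comp R (@Lambda R) (fun t : R => a i * t + c i) t _ _ H2 H1.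
  have H4 : is_derive t 1 (fun t : R => y i *: (a i * t + c i)) (y i *: a i).
    exact: is_deriveZ.
  have H5 := is_deriveB H4 H3.
  have -> : a i * (y i - sig (a i * t + c i)) =
    y i *: a i - sig (a i * t + c i) * a i by rewrite /GRing.scale/=; ring.
  exact: H5.
have -> : (fun t => \sum_i (y i * (a i * t + c i) - Lambda (a i * t + c i))) =
  \sum_i (fun t => y i * (a i * t + c i) - Lambda (a i * t + c i)).
  by apply/funext => u; rewrite fct_sumE.
exact: is_derive_sum.
Qed.

Definition scores (p : R * R) : R * R :=
  (\sum_i m i * (y i - sig (p.1 * m i + p.2)),
   \sum_i (y i - sig (p.1 * m i + p.2))).

Lemma scores0_of_max (p : R * R) (r : R) : 0 < r ->
  (forall q, `|q.1 - p.1| < r -> `|q.2 - p.2| < r -> plik q <= plik p) ->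
  scores p = (0, 0).
Proof.
move=> r0 pmax; congr pair.
- have E : (fun t => \sum_i (y i * (m i * t + p.2) - Lambda (m i * t + p.2))) =
    (fun t => plik (t, p.2)).
    apply/funext => t; apply: eq_bigr => i _; by rewrite /= (mulrC t).
  have H t := is_derive_plik m (fun=> p.2) t; rewrite E in H.
  have [] : is_derive p.1 1 (fun t => plik (t, p.2)) 0.
    apply: (@derive1_at_max _ _ (p.1 - r) (p.1 + r)).
    + lra.
    + by move=> t _; have [] := H t.
    + by rewrite in_itv/=; lra.
    + move=> t; rewrite in_itv/= => tr.
      rewrite [X in _ <= plik X](_ : _ = p); last by case: (p).
      by apply: pmax => /=; rewrite ?subrr ?normr0// ltr_norml; lra.
  move=> _; have [_ ->] := H p.1 => E0; rewrite -[RHS]E0.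
  by apply: eq_bigr => i _; rewrite (mulrC p.1).
- have E : (fun t => \sum_i (y i * (1 * t + p.1 * m i) - Lambda (1 * t + p.1 * m i))) =
    (fun t => plik (p.1, t)).
    by apply/funext => t; apply: eq_bigr => i _; rewrite /= mul1r (addrC t).
  have H t := is_derive_plik (fun=> 1) (fun i => p.1 * m i) t; rewrite E in H.
  have [] : is_derive p.2 1 (fun t => plik (p.1, t)) 0.
    apply: (@derive1_at_max _ _ (p.2 - r) (p.2 + r)).
    + lra.
    + by move=> t _; have [] := H t.
    + by rewrite in_itv/=; lra.
    + move=> t; rewrite in_itv/= => tr.
      rewrite [X in _ <= plik X](_ : _ = p); last by case: (p).
      by apply: pmax => /=; rewrite ?subrr ?normr0// ltr_norml; lra.
  move=> _; have [_ ->] := H p.2 => E0; rewrite -[RHS]E0.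
  by apply: eq_bigr => i _; rewrite !mul1r (addrC p.2).
Qed.

(** * Strong concavity when the fields have variance at least [c] *)

Variables (D c : R).
Hypothesis m0D : forall i, 0 <= m i <= D.
Let mbar := N%:R^-1 * \sum_i m i.
Hypothesis c0 : 0 < c.
Hypothesis Tc : c <= N%:R^-1 * \sum_i (m i - mbar) ^+ 2.

Let N0 : 0 < N%:R :> R.
Proof.
rewrite ltr0n lt0n; apply/negP => /eqP N0.
(* With [N = 0] the convention [0^-1 = 0] would make the variance vanish, against [Tc]. *)
have z : N%:R^-1 = 0 :> R by rewrite N0 invr0.
by move: Tc; rewrite z mul0r leNgt c0.
Qed.

Let D0 : 0 <= D.
Proof.
have i : 'I_N by apply: (@Ordinal _ 0); move: N0; rewrite ltr0n.
by have := m0D i; lra.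
Qed.

(** Variance decomposition around [mbar]: the cross term sums to zero. *)
Let quadE u v : \sum_i (u * m i + v) ^+ 2 =
  N%:R * (u ^+ 2 * (N%:R^-1 * \sum_i (m i - mbar) ^+ 2) + (u * mbar + v) ^+ 2).
Proof.
have S0 : \sum_i (m i - mbar) = 0.
  rewrite sumrB sumr_const card_ord -[X in _ - X]mulr_natr /mbar mulrAC mulVf ?mul1r ?subrr//.
  exact: lt0r_neq0.
have E i : (u * m i + v) ^+ 2 = u ^+ 2 * (m i - mbar) ^+ 2 +
  (2 * u * (u * mbar + v) * (m i - mbar) + (u * mbar + v) ^+ 2) by ring.
rewrite (eq_bigr _ (fun i _ => E i)) !big_split/= -!mulr_sumr S0 sumr_const card_ord.
rewrite -[(u * mbar + v) *+ N]mulr_natr; field; exact: lt0r_neq0.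
Qed.

Let mbar0D : 0 <= mbar <= D.
Proof.
rewrite /mbar mulr_ge0 ?invr_ge0 ?sumr_ge0//= => [|i _]; last first.
  by case/andP: (m0D i).
rewrite ler_pdivrMl// (le_trans (ler_sum _ (fun i _ => proj2 (andP (m0D i)))))//.
by rewrite sumr_const card_ord mulr_natl.
Qed.

(** The reciprocal of the sum of the two factors by which the form per site bounds [u ^+ 2] and
    [v ^+ 2]. *)
Definition quad_cst : R := (c^-1 + (2 + 2 * D ^+ 2 / c))^-1.

Lemma quad_cst_gt0 : 0 < quad_cst.
Proof.
by rewrite invr_gt0 addr_gt0 ?invr_gt0// ltr_wpDr// divr_ge0 ?mulr_ge0 ?exprn_ge0// ltW.
Qed.

(** The variance term of [quadE] controls [u]; then [v] is the difference of [u * mbar + v] and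
    [u * mbar], both controlled. *)
Lemma quad_lb u v r : r <= `|u| \/ r <= `|v| -> 0 <= r ->
  N%:R * (quad_cst * r ^+ 2) <= \sum_i (u * m i + v) ^+ 2.
Proof.
move=> ruv r0; rewrite quadE ler_pM2l//.
set q := _ + _; rewrite /quad_cst mulrC ler_pdivrMr; last first.
  by have := quad_cst_gt0; rewrite invr_gt0.
have uq : u ^+ 2 <= q / c.
  rewrite ler_pdivlMr// /q (le_trans (ler_wpM2l _ Tc)) ?sqr_ge0//.
  by rewrite lerDl sqr_ge0.
have q0 : 0 <= q.
  by have := le_trans (sqr_ge0 u) uq; rewrite pmulr_lge0// invr_gt0.
have vq : v ^+ 2 <= 2 * q + 2 * (q / c) * D ^+ 2.
  have e : v ^+ 2 = ((u * mbar + v) - u * mbar) ^+ 2 by ring.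
  apply: (@le_trans _ _ (2 * (u * mbar + v) ^+ 2 + 2 * (u ^+ 2 * mbar ^+ 2))).
    by rewrite e -exprMn; exact: sqrB_le.
  rewrite lerD//.
    by rewrite ler_pM2l// /q lerDr mulr_ge0 ?sqr_ge0// (le_trans (ltW c0) Tc).
  rewrite -mulrA ler_pM2l// ler_pM ?sqr_ge0//.
  by have /andP[? ?] := mbar0D; rewrite ler_pXn2r.
have rl w : r <= `|w| -> r ^+ 2 <= w ^+ 2.
  by move=> rw; rewrite -(real_normK (num_real w)) ler_pXn2r.
have -> : q * (c^-1 + (2 + 2 * D ^+ 2 / c)) = q / c + (2 * q + 2 * (q / c) * D ^+ 2).
  by ring.
have qc0 : 0 <= q / c by rewrite divr_ge0// ltW.
have d2 : 0 <= q / c * D ^+ 2 by rewrite mulr_ge0 ?sqr_ge0.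
case: ruv => /rl; first by move: uq; lra.
by move: vq; lra.
Qed.

(** Pairing the difference of the scores with [q - p] dominates a positive multiple of the quadratic
    form of [quad_lb], so two zeros coincide. *)
Lemma scores_inj p q : scores p = (0, 0) -> scores q = (0, 0) -> p = q.
Proof.
move=> [p1 p2] [q1 q2].
(* Bounds the linear predictors of both parameters at all sites, so that one modulus serves for
   all. *)
pose K := (`|p.1| * D + `|p.2|) + (`|q.1| * D + `|q.2|).
have bnd (s : R * R) i : `|s.1 * m i + s.2| <= `|s.1| * D + `|s.2|.
  rewrite (le_trans (ler_normD _ _))// lerD2r normrM ler_wpM2l//.
  by have /andP[m0 mD] := m0D i; rewrite ger0_norm.
have E : \sum_i (sig (q.1 * m i + q.2) - sig (p.1 * m i + p.2)) *
   ((q.1 * m i + q.2) - (p.1 * m i + p.2)) = 0.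
  transitivity ((q.1 - p.1) * ((scores p).1 - (scores q).1) +
    (q.2 - p.2) * ((scores p).2 - (scores q).2)); last first.
    by rewrite /= p1 q1 p2 q2 !subrr !mulr0 addr0.
  rewrite /= -!sumrB !mulr_sumr -big_split/=.
  by apply: eq_bigr => i _; ring.
have H : sig_modulus K * \sum_i ((q.1 - p.1) * m i + (q.2 - p.2)) ^+ 2 <= 0.
  rewrite -[leRHS]E mulr_sumr; apply: ler_sum => i _.
  have -> : (q.1 - p.1) * m i + (q.2 - p.2) =
    (q.1 * m i + q.2) - (p.1 * m i + p.2) by ring.
  apply: sig_strong; rewrite /K (le_trans (bnd _ i))// ?lerDl ?lerDr;
    by rewrite addr_ge0 ?mulr_ge0.
have Z r : r <= `|q.1 - p.1| \/ r <= `|q.2 - p.2| -> 0 <= r -> r <= 0.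
  move=> rr r0; have := quad_lb rr r0 => H1; rewrite leNgt; apply/negP => rp.
  have : 0 < N%:R * (quad_cst * r ^+ 2) by rewrite !mulr_gt0 ?quad_cst_gt0 ?exprn_gt0.
  move: H; rewrite pmulr_rle0 ?sig_modulus_gt0//; lra.
have z1 : q.1 - p.1 = 0.
  apply/eqP; rewrite -normr_eq0 eq_le normr_ge0 andbT; apply: Z; [by left|by []].
have z2 : q.2 - p.2 = 0.
  apply/eqP; rewrite -normr_eq0 eq_le normr_ge0 andbT; apply: Z; [by right|by []].
by case: p q {p1 p2 q1 q2 K bnd E H Z} z1 z2 => [? ?] [? ?] /= z1 z2; congr pair; lra.
Qed.

(** * A zero of the score near the true parameter *)

Section Local.
Variables (beta h : R).

(** Curvature per site on the unit box around [(beta, h)]: the argument of [sig_modulus] bounds the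
    linear predictors there. *)
Definition mple_cst : R :=
  sig_modulus ((`|beta| + 1) * D + (`|h| + 1)) * quad_cst.

Let s := scores (beta, h).

(* Compare with the midpoint: strong concavity at [(beta, h)], combined with
   the tangent bound at the midpoint, makes the midpoint strictly better. *)
Let boundary p r : 0 < r <= 1 ->
  `|s.1| + `|s.2| < mple_cst * r * N%:R / 2 ->
  `|p.1 - beta| <= r -> `|p.2 - h| <= r ->
  r <= `|p.1 - beta| \/ r <= `|p.2 - h| ->
  plik p < plik ((p.1 + beta) / 2, (p.2 + h) / 2).
Proof.
move=> /andP[r0 r1] sr p1 p2 rp.
set u := p.1 - beta; set v := p.2 - h.
set K := (`|beta| + 1) * D + (`|h| + 1).
have bnd a b i : `|a - beta| <= 1 -> `|b - h| <= 1 -> `|a * m i + b| <= K.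
  move=> a1 b1; rewrite (le_trans (ler_normD _ _))// /K lerD//.
    have /andP[m0 mD] := m0D i; rewrite normrM ler_pM//; last by rewrite ger0_norm.
    by have := ler_normD (a - beta) beta; rewrite subrK; lra.
  by have := ler_normD (b - h) h; rewrite subrK; lra.
have half a b : `|a - b| <= r -> `|(a + b) / 2 - b| <= 1.
  move=> ab; have -> : (a + b) / 2 - b = (a - b) / 2 by field.
  by rewrite normrM (ger0_norm (x := 2^-1)) ?invr_ge0//; lra.
have step i : (y i * (p.1 * m i + p.2) - Lambda (p.1 * m i + p.2)) -
    (y i * ((p.1 + beta) / 2 * m i + (p.2 + h) / 2) -
     Lambda ((p.1 + beta) / 2 * m i + (p.2 + h) / 2)) <=
    (u * (m i * (y i - sig (beta * m i + h))) + v * (y i - sig (beta * m i + h))) / 2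
    - sig_modulus K / 4 * (u * m i + v) ^+ 2.
  set a := beta * m i + h; set b := p.1 * m i + p.2; set z := _ + (p.2 + h) / 2.
  have zE : z = (a + b) / 2 by rewrite /z /a /b; ring.
  have uE : u * m i + v = b - a by rewrite /u /v /a /b; ring.
  have T := Lambda_tangent b z.
  have S : sig_modulus K * (z - a) ^+ 2 <= (sig z - sig a) * (z - a).
    apply: sig_strong; first by apply: bnd; rewrite subrr normr0.
    by apply: bnd; apply: half.
  have -> : u * (m i * (y i - sig a)) + v * (y i - sig a) =
     (u * m i + v) * (y i - sig a) by ring.
  rewrite uE; move: T S; rewrite zE.
  have -> : (a + b) / 2 - a = (b - a) / 2 by field.
  have -> : b - (a + b) / 2 = (b - a) / 2 by field.
  have -> : ((b - a) / 2) ^+ 2 = (b - a) ^+ 2 / 4 by field.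
  set q := sig _; set k := sig_modulus K; set e := (b - a) ^+ 2.
  rewrite mulrBl mulrBr; set La := Lambda _; set Lb := Lambda b => T S.
  have : y i * b - y i * ((a + b) / 2) = y i * ((b - a) / 2) by field.
  lra.
have Q := quad_lb rp (ltW r0).
have D1 : plik p - plik ((p.1 + beta) / 2, (p.2 + h) / 2) <=
   (u * s.1 + v * s.2) / 2 - sig_modulus K / 4 * \sum_i (u * m i + v) ^+ 2.
  rewrite /plik -sumrB (le_trans (ler_sum _ (fun i _ => step i)))//=.
  by rewrite sumrB -mulr_suml big_split/= -!mulr_sumr.
have us : u * s.1 + v * s.2 <= r * (`|s.1| + `|s.2|).
  rewrite mulrDr lerD// (le_trans (ler_norm _))// normrM ler_wpM2r//.
have rs : r * (`|s.1| + `|s.2|) < r * (mple_cst * r * N%:R / 2) by rewrite ltr_pM2l.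
have kQ : sig_modulus K / 4 * (N%:R * (quad_cst * r ^+ 2)) <=
    sig_modulus K / 4 * \sum_i (u * m i + v) ^+ 2.
  by rewrite ler_wpM2l// divr_ge0// ltW// sig_modulus_gt0.
have e : r * (mple_cst * r * N%:R / 2) / 2 =
  sig_modulus K / 4 * (N%:R * (quad_cst * r ^+ 2)) by rewrite /mple_cst /K; field.
lra.
Qed.

(** A maximiser over the compact box cannot touch the boundary, since its midpoint with the centre
    would be better and lies in the box; an interior maximiser has zero score. *)
Lemma scores_zero_near r : 0 < r <= 1 ->
  `|s.1| + `|s.2| < mple_cst * r * N%:R / 2 ->
  exists p, [/\ scores p = (0, 0), `|p.1 - beta| < r & `|p.2 - h| < r].
Proof.
move=> r01 sr; have /andP[r0 r1] := r01.
pose box := [set p : R * R | `|p.1 - beta| <= r /\ `|p.2 - h| <= r].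
have cbox : compact box.
  have -> : box = (`[(beta - r)%R, (beta + r)%R] `*` `[(h - r)%R, (h + r)%R]).
    apply/seteqP; split => p; rewrite /box /= !in_itv/= !ler_norml;
      by move=> [/andP[? ?] /andP[? ?]]; split; apply/andP; split; lra.
  by apply: compact_setX; exact: segment_compact.
have [|//|p] := @compact_EVT_max _ R plik box _ cbox.
- by exists (beta, h); rewrite /box /= !subrr normr0; split; lra.
- exact/continuous_subspaceT/continuous_plik.
rewrite inE => -[p1 p2] pmax.
have pmax' q : `|q.1 - beta| <= r -> `|q.2 - h| <= r -> plik q <= plik p.
  by move=> q1 q2; apply: pmax; rewrite inE.
have half a b : `|a - b| <= r -> `|(a + b) / 2 - b| <= r.
  move=> ab; have -> : (a + b) / 2 - b = (a - b) / 2 by field.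
  by rewrite normrM (ger0_norm (x := 2^-1)) ?invr_ge0//; have := normr_ge0 (a - b); lra.
have [p1' p2'] : `|p.1 - beta| < r /\ `|p.2 - h| < r.
  case: (ltP `|p.1 - beta| r) => a1; last first.
    have := boundary r01 sr p1 p2 (or_introl a1).
    by rewrite ltNge pmax'//=; exact: half.
  case: (ltP `|p.2 - h| r) => a2 //.
  have := boundary r01 sr p1 p2 (or_intror a2).
  by rewrite ltNge pmax'//=; exact: half.
exists p; split => //.
pose r' := Num.min (r - `|p.1 - beta|) (r - `|p.2 - h|).
apply: (@scores0_of_max _ r') => [|q].
  by rewrite lt_min !subr_gt0 p1'.
rewrite !lt_min => /andP[a1 a2] /andP[b1 b2]; apply: pmax'.
  by have := ler_normD (q.1 - p.1) (p.1 - beta); rewrite addrA subrK; lra.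
by have := ler_normD (q.2 - p.2) (p.2 - h); rewrite addrA subrK; lra.
Qed.

End Local.
End PseudoLikelihood.

(** * Asymptotics *)

Section Chebyshev.
Local Open Scope classical_set_scope.
Variables (R : realType) (N : nat) (A : tensor R N) (D : R).
Hypothesis hA : regular D A.
Variables (beta h : R).

Lemma gibbs_chebyshev (E : set (config N)) (f : config N -> R) a : 0 < a ->
  (forall x, E x -> a <= `|f x|) ->
  gibbs A beta h E <= expect A beta h (fun x => f x ^+ 2) / a ^+ 2.
Proof.
move=> a0 Ea.
have -> : expect A beta h (fun x => f x ^+ 2) / a ^+ 2 =
  expect A beta h (fun x => f x ^+ 2 / a ^+ 2).
  by rewrite /expect mulr_suml; apply: eq_bigr => x _; rewrite mulrA.
apply: gibbs_markov => x; first by rewrite divr_ge0 ?sqr_ge0.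
move=> /Ea h1; rewrite ler_pdivlMr ?exprn_gt0// mul1r.
by rewrite -(real_normK (num_real (f x))) ler_pXn2r// nnegrE ltW.
Qed.

Lemma gibbs_gap e : 0 < e -> (0 < N)%N -> gibbs A beta h
  [set x | e * N%:R <= \sum_i fixed_pt_gap A beta h x i ^+ 2]
  <= gap_cst D beta / e ^+ 2 / N%:R.
Proof.
move=> e0 N0; have N0' : 0 < N%:R :> R by rewrite ltr0n.
apply: (@le_trans _ _ (expect A beta h
  (fun x => (\sum_i fixed_pt_gap A beta h x i ^+ 2) ^+ 2) / (e * N%:R) ^+ 2)).
  apply: gibbs_chebyshev; first by rewrite mulr_gt0.
  by move=> x /= h1; rewrite (le_trans h1)// ler_norm.
rewrite ler_pdivrMr ?exprn_gt0 ?mulr_gt0// (le_trans (expect_gap2 hA _ _))//.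
by rewrite le_eqVlt; apply/orP; left; apply/eqP; field; rewrite !lt0r_neq0.
Qed.

Let scr x := scores (local_field A x) (ind R x) (beta, h).

(** The constants of [second_moment] with [(B, K) = (D, 2 D)] for the first score and [(1, 0)] for
    the second, doubled because the square of a sum is at most twice the sum of squares. *)
Definition score_cst : R :=
  2 * ((2 * D * D + D * (2 * D + D + D * (`|beta| * (2 * D)))) +
       (0 * 1 + 1 * (0 + 1 + 1 * (`|beta| * (2 * D))))).

Lemma gibbs_scores a : 0 < a ->
  gibbs A beta h [set x | a <= `|(scr x).1| + `|(scr x).2|]
  <= score_cst * N%:R / a ^+ 2.
Proof.
move=> a0.
pose f x := `|(scr x).1| + `|(scr x).2|.
apply: (le_trans (@gibbs_chebyshev _ f a a0 _)).
  by move=> x /= h1; rewrite (le_trans h1)// ler_norm.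
rewrite ler_pM2r ?invr_gt0 ?exprn_gt0//.
have H1 : expect A beta h (fun x => (scr x).1 ^+ 2) <=
   (2 * D * D + D * (2 * D + D + D * (`|beta| * (2 * D)))) * N%:R.
  apply: (@second_moment _ _ _ _ hA beta h (fun i x => local_field A x i) D (2 * D)) => i.
    by move=> x; have := local_field01 hA x i => ?; rewrite ger0_norm; lra.
  exact: lip_local_field.
have H2 : expect A beta h (fun x => (scr x).2 ^+ 2) <=
   (0 * 1 + 1 * (0 + 1 + 1 * (`|beta| * (2 * D)))) * N%:R.
  have E : (fun x => (scr x).2 ^+ 2) =1
    (fun x => (\sum_i 1 * (ind R x i - cmean A beta h x i)) ^+ 2).
    by move=> x; congr (_ ^+ 2); apply: eq_bigr => i _; rewrite mul1r.
  rewrite (eq_expect _ _ _ E).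
  apply: (@second_moment _ _ _ _ hA beta h (fun i x => 1) 1 0) => i; last exact: lip_cst.
  by move=> x; rewrite normr1.
apply: (@le_trans _ _ (expect A beta h
  (fun x => (scr x).1 ^+ 2 + (scr x).2 ^+ 2 + ((scr x).1 ^+ 2 + (scr x).2 ^+ 2)))).
  apply: expect_le => x; rewrite /f.
  have := sqrB_le `|(scr x).1| (- `|(scr x).2|).
  by rewrite opprK sqrrN !real_normK ?num_real//; lra.
rewrite !expectD /score_cst; lra.
Qed.

End Chebyshev.

(** * Vanishing events and consistency of the MPLE *)

Section Asymptotics.
Local Open Scope classical_set_scope.
Variables (R : realType) (A : forall N, tensor R N) (D beta h : R).
Arguments A : clear implicits.
Hypothesis hA : forall N, regular D (A N).

(** The epsilon form of [whp_not], for which upper bounds suffice. *)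
Definition vanishing (E : forall N, set (config N)) :=
  forall e : R, 0 < e -> \forall N \near \oo, gibbs (A N) beta h (E N) <= e.

Lemma vanishingP E : vanishing E <-> whp_not A beta h E.
Proof.
split=> [vE|/cvgrPdist_le cE e e0].
  apply/cvgrPdist_le => e e0; near=> N.
  rewrite sub0r normrN ger0_norm ?gibbs_ge0//.
  by near: N; exact: vE.
near=> N; have : `|0 - gibbs (A N) beta h (E N)| <= e by near: N; exact: cE.
by rewrite sub0r normrN ger0_norm ?gibbs_ge0.
Unshelve. all: by end_near.
Qed.

Lemma vanishing_near E F : (\forall N \near \oo, E N `<=` F N) ->
  vanishing F -> vanishing E.
Proof.
move=> EF vF e e0; near=> N.
apply: (@le_trans _ _ (gibbs (A N) beta h (F N))).
  by apply: gibbs_sub; near: N.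
by near: N; exact: vF.
Unshelve. all: by end_near.
Qed.

Lemma vanishing_whp E : vanishing (fun N => ~` E N) -> whp A beta h E.
Proof.
move=> vE; apply/cvgrPdist_le => e e0; near=> N.
rewrite -gibbsC ger0_norm ?gibbs_ge0//.
by near: N; exact: vE.
Unshelve. all: by end_near.
Qed.

Lemma near_invn (C e : R) : 0 < e -> \forall N \near \oo, (0 < N)%N /\ C / N%:R <= e.
Proof.
move=> e0; near=> N.
have N1 : (0 < N)%N by near: N; exists 1%N.
have NC : C / e <= N%:R by near: N; exact: nbhs_infty_ger.
split => //; rewrite ler_pdivrMr ?ltr0n// -ler_pdivrMl// mulrC //.
Unshelve. all: by end_near.
Qed.

Lemma vanishing_bound E C :
  (forall N, (0 < N)%N -> gibbs (A N) beta h (E N) <= C / N%:R) -> vanishing E.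
Proof.
move=> H e e0; near=> N.
have [N0 CN] : (0 < N)%N /\ C / N%:R <= e by near: N; exact: near_invn.
exact: le_trans (H N N0) CN.
Unshelve. all: by end_near.
Qed.

Lemma vanishing_gap e : 0 < e -> vanishing (fun N =>
  [set x | e * N%:R <= \sum_i fixed_pt_gap (A N) beta h x i ^+ 2]).
Proof. by move=> e0; apply: vanishing_bound => N N0; exact: gibbs_gap. Qed.

Lemma pl_equationsP N (x : config N) p : pl_equations (A N) x p <->
  scores (local_field (A N) x) (ind R x) p = (0, 0).
Proof.
by rewrite /pl_equations derive1_Lambda /scores; split=> [[-> ->]|[]].
Qed.

(** A deterministic statement: [scores_zero_near] supplies a solution and [scores_inj] its
    uniqueness. *)
Lemma MPLE_near c r N (x : config N) : 0 < c -> c <= T_stat (A N) x -> 0 < r <= 1 ->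
  `|(scores (local_field (A N) x) (ind R x) (beta, h)).1| +
  `|(scores (local_field (A N) x) (ind R x) (beta, h)).2|
    < mple_cst D c beta h * r * N%:R / 2 ->
  MPLE_exists (A N) x /\ MPLE_error A beta h x <= r.
Proof.
move=> c0 cT r01 sr.
have m0D i := local_field01 (hA N) x i.
have [p [p0 p1 p2]] := scores_zero_near m0D c0 cT r01 sr.
have up : unique (pl_equations (A N) x) p.
  split; first exact/pl_equationsP.
  by move=> q /pl_equationsP q0; exact: (scores_inj m0D c0 cT p0 q0).
split; first by exists p.
(* As a unique solution exists, [xget] returns it and not the default [(0, 0)]. *)
have MP : unique (pl_equations (A N) x) (MPLE (A N) x).
  by rewrite /MPLE; case: xgetP => [q -> //|/(_ p)]; case.
have -> : MPLE_error A beta h x = Num.max `|p.1 - beta| `|p.2 - h|.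
  by rewrite /MPLE_error -(up.2 _ MP.1).
by rewrite ge_max !ltW.
Qed.

Section Consistency.
Variable c : R.
Hypothesis c0 : 0 < c.
Hypothesis vT : vanishing (fun N => [set x | T_stat (A N) x < c]).

Let k := mple_cst D c beta h.

Let k_gt0 N : (0 < N)%N -> 0 < k.
Proof.
move=> N0; have D0 := regular_ge0 (hA N) (Ordinal N0).
rewrite mulr_gt0 ?sig_modulus_gt0// /quad_cst invr_gt0 addr_gt0 ?invr_gt0//.
by rewrite ltr_wpDr// divr_ge0 ?mulr_ge0 ?exprn_ge0// ltW.
Qed.

Let bad r N (x : config N) : 0 < r <= 1 ->
  ~ (MPLE_exists (A N) x /\ MPLE_error A beta h x <= r) ->
  T_stat (A N) x < c \/ k * r * N%:R / 2 <=
  `|(scores (local_field (A N) x) (ind R x) (beta, h)).1| +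
  `|(scores (local_field (A N) x) (ind R x) (beta, h)).2|.
Proof.
move=> r01 H; case: (ltP (T_stat (A N) x) c) => cT; [by left|right].
by rewrite leNgt; apply/negP => sr; apply: H; exact: (MPLE_near c0 cT r01 sr).
Qed.

(** Chebyshev for the score at the threshold of [MPLE_near]. Existence uses [r = 1], the rate uses
    [r = M / sqrt N]. *)
Let gibbs_bad r N (E : set (config N)) : (0 < N)%N -> 0 < r <= 1 ->
  (forall x, E x -> ~ (MPLE_exists (A N) x /\ MPLE_error A beta h x <= r)) ->
  gibbs (A N) beta h E <= gibbs (A N) beta h [set x | T_stat (A N) x < c] +
   4 * score_cst D beta / k ^+ 2 / (r ^+ 2 * N%:R).
Proof.
move=> N0 r01 HE; have /andP[r0 r1] := r01.
have N0' : 0 < N%:R :> R by rewrite ltr0n.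
have k0 := k_gt0 N0.
apply: (le_trans (gibbs_sub _ _ _ (fun x Ex => bad r01 (HE x Ex)))).
apply: (le_trans (gibbsU _ _ _ _ _)); rewrite lerD2l.
apply: (le_trans (gibbs_scores (hA N) beta h _)).
  by rewrite divr_gt0 // mulr_gt0 // mulr_gt0.
by rewrite le_eqVlt; apply/orP; left; apply/eqP; field; rewrite !lt0r_neq0.
Qed.

Lemma MPLE_exists_whp_of_T : MPLE_exists_whp A beta h.
Proof.
apply: vanishing_whp => e e0; near=> N.
have [N0 CN] : (0 < N)%N /\ 4 * score_cst D beta / k ^+ 2 / N%:R <= e / 2.
  by near: N; apply: near_invn; rewrite divr_gt0.
have TN : gibbs (A N) beta h [set x | T_stat (A N) x < c] <= e / 2.
  by near: N; apply: vT; rewrite divr_gt0.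
apply: (le_trans (@gibbs_bad 1 N _ N0 _ _)).
- by rewrite ltr01 lexx.
- by move=> x /= H [].
- by rewrite expr1n mul1r; lra.
Unshelve. all: by end_near.
Qed.

Lemma jointly_sqrt_consistent_of_T : jointly_sqrt_consistent A beta h.
Proof.
move=> e e0.
(* Makes the Chebyshev term, divided by [M ^+ 2], at most [e / 2]; the summand 1 keeps [M]
   positive. *)
have [M M0 M2] : exists2 M : R, 0 < M &
    M ^+ 2 = 1 + `|4 * score_cst D beta / k ^+ 2| / (e / 2).
  exists (Num.sqrt (1 + `|4 * score_cst D beta / k ^+ 2| / (e / 2))).
    by rewrite sqrtr_gt0 ltr_wpDr// divr_ge0// ltW// divr_gt0.
  by rewrite sqr_sqrtr// addr_ge0// divr_ge0// ltW// divr_gt0.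
exists M => //; near=> N.
have [N0 _] : (0 < N)%N /\ 0 / N%:R <= e by near: N; exact: near_invn.
(* Ensures that the radius [M / sqrt N] is at most 1. *)
have NM : M ^+ 2 <= N%:R by near: N; exact: nbhs_infty_ger.
have TN : gibbs (A N) beta h [set x | T_stat (A N) x < c] <= e / 2.
  by near: N; apply: vT; rewrite divr_gt0.
have N0' : 0 < N%:R :> R by rewrite ltr0n.
have sN : 0 < Num.sqrt N%:R :> R by rewrite sqrtr_gt0.
apply: (le_trans (@gibbs_bad (M * (Num.sqrt N%:R)^-1) N _ N0 _ _)).
- rewrite mulr_gt0 ?invr_gt0//= ler_pdivrMr// mul1r.
  by rewrite -[M](ger0_norm (ltW M0)) -sqrtr_sqr ler_wsqrtr.
- move=> x /= H [_]; apply/negP; rewrite -ltNge; apply: (lt_le_trans H).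
  by rewrite ger0_norm// /MPLE_error le_max normr_ge0.
- have -> : (M * (Num.sqrt N%:R)^-1) ^+ 2 * N%:R = M ^+ 2.
    by rewrite exprMn exprVn sqr_sqrtr ?(ltW N0')// divfK ?lt0r_neq0.
  rewrite [e](splitr e) lerD// ler_pdivrMr ?exprn_gt0// M2 mulrDr mulr1.
  rewrite [e / 2 * _]mulrC divfK ?lt0r_neq0 ?divr_gt0//.
  by rewrite (le_trans (ler_norm _))// lerDr ltW// divr_gt0.
Unshelve. all: by end_near.
Qed.

Lemma Omega_p1_of_T : Omega_p1 A beta h (fun N => T_stat (A N)).
Proof.
move=> e /cvgrPdist_lt e_to0; apply/vanishingP.
apply: (vanishing_near _ vT); near=> N => x /= Te.
apply: (le_lt_trans Te).
have : `|0 - e N| < c by near: N; exact: e_to0.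
by rewrite sub0r normrN => /(le_lt_trans (ler_norm _)).
Unshelve. all: by end_near.
Qed.

End Consistency.
End Asymptotics.

(** * Progressions in the integers *)

Section FormsAP.
Variables (N : nat) (ap : 'I_N -> 'I_N -> 'I_N -> bool).
Hypothesis ap_sym : forall a b c, ap a b c = ap c b a.
Hypothesis ap_neq : forall a b c, ap a b c -> [&& a != b, b != c & a != c].

(** Up to reversal an ordering is determined by its middle term, here [b], [a] or [c]. *)
Lemma forms_apE (a b c : 'I_N) :
  forms_ap ap [set a; b; c]%SET = [|| ap a b c, ap b a c | ap a c b].
Proof.
apply/idP/idP; last first.
  case/or3P => H; apply/existsP.
  - by exists a; apply/existsP; exists b; apply/existsP; exists c; rewrite eqxx.
  - exists b; apply/existsP; exists a; apply/existsP; exists c.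
    by rewrite H andbT; apply/eqP/setP => z; rewrite !inE (orbC (z == a)).
  - exists a; apply/existsP; exists c; apply/existsP; exists b.
    by rewrite H andbT; apply/eqP/setP => z; rewrite !inE orbAC.
case/existsP => p /existsP[q /existsP[r /andP[/eqP/setP S pqr]]].
have /and3P[pq qr pr] := ap_neq pqr.
have := S p; have := S q; have := S r; rewrite !inE !eqxx !orbT /=.
(* All ways to match [p], [q], [r] with [a], [b], [c]: repetitions contradict distinctness, the
   others are a listed ordering or its reversal. *)
move=> /orP[/orP[]|] /eqP rE /orP[/orP[]|] /eqP qE /orP[/orP[]|] /eqP pE;
  move: pq qr pr pqr; rewrite rE qE pE ?eqxx//= => _ _ _ H;
  first [by rewrite H ?orbT | by rewrite ap_sym in H; rewrite H ?orbT].
Qed.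

Variable R : realType.
Let A (a b c : 'I_N) : R := N%:R^-1 * (forms_ap ap [set a; b; c]%SET)%:R.

Lemma ap_tensor_sum a b : \sum_c A a b c =
  (\sum_c [|| ap a b c, ap b a c | ap a c b])%N%:R / N%:R.
Proof.
rewrite natr_sum mulrC mulr_sumr; apply: eq_bigr => c _.
by rewrite /A forms_apE.
Qed.

Lemma ap_tensor_sum2 a : bil A (fun=> 1) (fun=> 1) a =
  (\sum_b \sum_c [|| ap a b c, ap b a c | ap a c b])%N%:R / N%:R.
Proof.
rewrite natr_sum mulr_suml; apply: eq_bigr => b _.
by rewrite -ap_tensor_sum; apply: eq_bigr => c _; rewrite !mulr1.
Qed.

Lemma ap_regular m :
  (forall a b, a != b -> \sum_c [|| ap a b c, ap b a c | ap a c b] <= m)%N ->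
  regular m%:R A.
Proof.
have d0 a c : forms_ap ap [set a; a; c]%SET = false.
  rewrite forms_apE; apply/negbTE; rewrite !negb_or; apply/and3P.
  by split; apply/negP => /ap_neq/and3P[]; rewrite ?eqxx.
move=> Hm; split => [a b c|a b c|a c|a b c|a b].
- by rewrite /A (finset.setUC [set a]%SET).
- by rewrite /A finset.setUAC.
- by rewrite /A d0 mulr0.
- by rewrite /A mulr_ge0 ?invr_ge0.
- case: (eqVneq a b) => [->|ab].
    by rewrite big1 ?divr_ge0// => c _; rewrite /A d0 mulr0.
  by rewrite ap_tensor_sum ler_wpM2r ?invr_ge0// ler_nat Hm.
Qed.

End FormsAP.

Lemma sum_le1 (I : finType) (P : pred I) :
  (forall a b, P a -> P b -> a = b) -> (\sum_a P a <= 1)%N.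
Proof.
move=> H; case: (pickP P) => [a Pa|P0]; last first.
  by rewrite big1// => a _; rewrite P0.
rewrite (bigD1 a)//= big1 ?addn0 ?leq_b1// => b ba.
by apply/eqP; rewrite eqb0; apply/negP => Pb; case/eqP: ba; exact: H.
Qed.

Lemma ap_int_sym N (a b c : 'I_N) : ap_int a b c = ap_int c b a.
Proof. rewrite /ap_int -!val_eqE/=; lia. Qed.

Lemma ap_int_neq N (a b c : 'I_N) : ap_int a b c -> [&& a != b, b != c & a != c].
Proof. by case/and4P => -> -> ->. Qed.

(** Each of the three roles of the third term leaves at most one choice; the constant 4 is shared
    with the cyclic case. *)
Lemma regular_A_int (R : realType) N : regular 4%:R (@A_int R N).
Proof.
apply: (ap_regular (@ap_int_sym N) (@ap_int_neq N)) => a b ab.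
apply: (@leq_trans (\sum_(c < N) (((a + c == 2 * b)%N : nat) +
  ((b + c == 2 * a)%N + (a + b == 2 * c)%N)))%N).
  apply: leq_sum => c _; rewrite /ap_int -!val_eqE/=; lia.
rewrite !big_split/=; apply: (@leq_trans (1 + (1 + 1))%N) => //.
by rewrite !leq_add ?sum_le1// => x y /eqP e1 /eqP e2; apply: val_inj => /=; lia.
Qed.

(** * Counting integer progressions through a site *)

Section IntCount.
Variable N : nat.

Definition int_count (a : 'I_N) : nat :=
  \sum_b \sum_c [|| ap_int a b c, ap_int b a c | ap_int a c b].

Lemma sum_lt_double t M : (\sum_(j < M) (2 * j < t : nat) = minn M (uphalf t))%N.
Proof.
elim: M => [|M IH]; first by rewrite big_ord0 min0n.
rewrite big_ord_recr/= IH; lia.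
Qed.

Lemma sum_lt_ord t M : (\sum_(j < M) (j < t : nat) = minn M t)%N.
Proof.
elim: M => [|M IH]; first by rewrite big_ord0 min0n.
rewrite big_ord_recr/= IH; lia.
Qed.

Lemma sum_eq_ord t M : (\sum_(j < M) (val j == t : nat) = (t < M))%N.
Proof.
elim: M => [|M IH]; first by rewrite big_ord0.
rewrite big_ord_recr/= IH; lia.
Qed.

(** [e1] counts progressions with endpoint [a] and [e2] those with middle term [a], the trivial one
    included. *)
Let e1 (a : 'I_N) := (\sum_(b < N) \sum_(c < N) (a + c == 2 * b)%N)%N.
Let e2 (a : 'I_N) := (\sum_(b < N) \sum_(c < N) (b + c == 2 * a)%N)%N.

Let e1E a : e1 a = (uphalf (N + a) - uphalf a)%N.
Proof.
have -> : e1 a = (\sum_(b < N) ((2 * b < N + a) - (2 * b < a)))%N.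
  apply: eq_bigr => b _.
  transitivity (\sum_(c < N) ((a <= 2 * b)%N * (val c == 2 * b - a)%N))%N.
    apply: eq_bigr => c _ /=; lia.
  rewrite -big_distrr/= sum_eq_ord; have := ltn_ord a; lia.
have := ltn_ord a => aN; rewrite sumnB => [|b _]; last lia.
by rewrite !sum_lt_double; lia.
Qed.

Let e2E (a : 'I_N) : (2 * a < N)%N -> e2 a = (2 * a).+1.
Proof.
move=> aN; have -> : e2 a = (\sum_(b < N) (b < (2 * a).+1)%N)%N.
  apply: eq_bigr => b _.
  transitivity (\sum_(c < N) ((b <= 2 * a)%N * (val c == 2 * a - b)%N))%N.
    apply: eq_bigr => c _ /=; lia.
  rewrite -big_distrr/= sum_eq_ord; lia.
by rewrite sum_lt_ord; lia.
Qed.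

(** The endpoint role occurs twice, for [b] or [c] in the middle. Over the integers the roles meet
    only at [a = b = c], which is counted three times. *)
Let countE a : (int_count a <= e1 a + (e2 a + e1 a) <= int_count a + 3)%N.
Proof.
have E3 : e1 a = (\sum_(b < N) \sum_(c < N) (a + b == 2 * c)%N)%N.
  by rewrite /e1 exchange_big.
rewrite {2 4}E3 /e1 /e2 /int_count -!big_split/=; apply/andP; split.
  apply: leq_sum => b _; rewrite -!big_split/=; apply: leq_sum => c _.
  rewrite /ap_int -!val_eqE/=; lia.
have <- : (\sum_(b < N) \sum_(c < N) 3 * ((val c == a) * (val b == a)) = 3)%N.
  rewrite (eq_bigr (fun b : 'I_N => 3 * (val b == a)))%N => [|b _]; last first.
    by rewrite -big_distrr -big_distrl/= sum_eq_ord ltn_ord mul1n.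
  by rewrite -big_distrr/= sum_eq_ord ltn_ord.
rewrite -big_split/=; apply: leq_sum => b _; rewrite -!big_split/=.
apply: leq_sum => c _; rewrite /ap_int -!val_eqE/=; lia.
Qed.

(** In the left half the endpoint count is [N / 2] up to rounding, while the middle count grows by 2
    per site. The slack 5 is 3 for trivial progressions and 2 for rounding. *)
Lemma int_count_gap (a b : 'I_N) : (a <= b)%N -> (2 * b < N)%N ->
  (int_count a + 2 * (b - a) <= int_count b + 5)%N.
Proof.
move=> ab bN; have := countE a; have := countE b.
by rewrite !e1E !e2E; lia.
Qed.

End IntCount.

(** From mean-square to mean absolute smallness, by summing [2 eta |u| <= eta^2 + u^2]. *)
Lemma sum_norm_le_sqr (R : realType) N (u : 'I_N -> R) eta : 0 < eta ->
  \sum_i u i ^+ 2 <= eta ^+ 2 * N%:R -> \sum_i `|u i| <= 2 * eta * N%:R.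
Proof.
move=> e0 H; have : \sum_i (2 * eta * `|u i|) <= \sum_i (eta ^+ 2 + u i ^+ 2).
  apply: ler_sum => i _; rewrite -(real_normK (num_real (u i))).
  by have := sqr_ge0 (eta - `|u i|); rewrite sqrrB; lra.
rewrite -mulr_sumr big_split/= sumr_const card_ord -[X in X + _]mulr_natr => H2.
have H3 : 2 * eta * \sum_i `|u i| <= 2 * eta * (eta * N%:R).
  by apply: (le_trans H2); apply: (le_trans (lerD (lexx _) H)); rewrite expr2; lra.
move: H3; rewrite ler_pM2l ?mulr_gt0// => /le_trans; apply.
by rewrite ler_wpM2r// ler_peMl ?ltW//; lra.
Qed.

(** * Consequences of nearly constant local fields *)

Section Flat.
Variables (R : realType) (N : nat) (A : tensor R N) (D : R).
Hypothesis hA : regular D A.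
Variables (beta h : R) (x : config N).

Lemma bil_norm_le v w i : (forall j, 0 <= w j <= 2) ->
  `|bil A v w i| <= 2 * (D / N%:R * \sum_j `|v j|).
Proof.
move=> hw; apply: (@le_trans _ _ (2 * bil A (fun j => `|v j|) (fun=> 1) i)); last first.
  rewrite ler_pM2l// (le_trans (bil1 hA _ _))// le_eqVlt; apply/orP; left.
  by apply/eqP; congr (_ * _); apply: eq_bigr => j _; rewrite normr_id.
rewrite /bil mulr_sumr (le_trans (ler_norm_sum _ _ _))// ler_sum// => j _.
rewrite mulr_sumr (le_trans (ler_norm_sum _ _ _))// ler_sum// => k _.
have /andP[w0 w2] := hw k.
rewrite !normrM (ger0_norm (tensor_ge0 hA _ _ _)) (ger0_norm w0) mulr1 [leRHS]mulrC.
by rewrite ler_wpM2l// mulr_ge0// (tensor_ge0 hA).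
Qed.

(** The gaps pay for replacing spins by conditional means, and the Lipschitz bound on [sig] for
    replacing those by [p]. *)
Lemma local_field_flat t p : p = sig (beta * t + h) ->
  \sum_i `|local_field A x i - p ^+ 2 * bil A (fun=> 1) (fun=> 1) i| <=
  \sum_i `|fixed_pt_gap A beta h x i| +
  2 * D * `|beta| * \sum_i `|local_field A x i - t|.
Proof.
move=> pE; pose c := cmean A beta h x.
have E i : p ^+ 2 * bil A (fun=> 1) (fun=> 1) i = bil A (fun=> p) (fun=> p) i.
  rewrite /bil mulr_sumr; apply: eq_bigr => j _; rewrite mulr_sumr.
  by apply: eq_bigr => k _; ring.
have cp i : `|bil A c c i - bil A (fun=> p) (fun=> p) i| <=
  2 * (D / N%:R * (`|beta| * \sum_j `|local_field A x j - t|)).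
  rewrite (bil_sqB hA); apply: (le_trans (bil_norm_le _ _ _)) => [j|].
    by have := cmean01 A beta h x j; have := sig_ge0 (beta * t + h);
       have := sig_le1 (beta * t + h); rewrite /c pE; lra.
  have D0 := regular_ge0 hA i.
  rewrite ler_pM2l// ler_wpM2l ?divr_ge0// mulr_sumr ler_sum// => j _.
  rewrite pE (le_trans (sig_lip _ _))// opprD addrACA subrr addr0 -mulrBr.
  by rewrite normrM.
apply: (@le_trans _ _ (\sum_i (`|fixed_pt_gap A beta h x i| +
   2 * (D / N%:R * (`|beta| * \sum_j `|local_field A x j - t|))))).
  apply: ler_sum => i _; apply: le_trans (lerD (lexx _) (cp i)).
  by rewrite E -[X in `|X - _|](subrK (bil A c c i)) -addrA ler_normD.
rewrite big_split/= lerD2l sumr_const card_ord.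
case: (posnP N) => N0; last first.
  rewrite -[leLHS]mulr_natr le_eqVlt; apply/orP; left; apply/eqP; field.
  by rewrite pnatr_eq0 -lt0n.
have -> : forall r : R, r *+ N = 0 by move=> r; rewrite N0 mulr0n.
rewrite [X in _ * X]big1// ?mulr0// => -[i iN]; exfalso; by rewrite N0 in iN.
Qed.

End Flat.

(** * The integer model *)

Section IntModel.
Variables (R : realType) (beta h : R).

(** Fields lie in [[0, 4]], so [p] is at least the value of [sig] used here. The flatness errors
    then total [4 eta (1 + 4 |beta|) N], half of the lower bound they must exceed. *)
Definition int_eta : R :=
  sig (- (`|beta| * 4 + `|h|)) ^+ 2 / (200 * (1 + 4 * `|beta|)).

Lemma int_eta_gt0 : 0 < int_eta.
Proof.
by rewrite divr_gt0 ?exprn_gt0 ?sig_gt0// mulr_gt0// ltr_wpDr// mulr_ge0.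
Qed.

(** Compare sites [i] and [i + r] with [i < r], [r] about [N / 4]: their row sums differ by at least
    [1 / 4], so [u] times the row sum cannot be close to [t] at both. *)
Lemma A_int_flat_spread N (u : R) (t : R) : (100 <= N)%N -> 0 <= u ->
  forall m : 'I_N -> R,
  u * N%:R / 25 <= \sum_i `|m i - u * bil (@A_int R N) (fun=> 1) (fun=> 1) i|
   + \sum_i `|m i - t|.
Proof.
move=> N100 u0 m; rewrite -big_split/=.
have N0 : 0 < N%:R :> R by rewrite ltr0n; lia.
pose a := bil (@A_int R N) (fun=> 1) (fun=> 1).
pose F i := `|m i - u * a i| + `|m i - t|; rewrite -[leRHS]/(\sum_i F i).
pose r := (N %/ 4)%N.
have r_lt (i : 'I_r) : (i < N)%N by have := ltn_ord i; rewrite /r; lia.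
have r_lt2 (i : 'I_r) : (i + r < N)%N by have := ltn_ord i; rewrite /r; lia.
pose f (i : 'I_r) := Ordinal (r_lt i); pose g (i : 'I_r) := Ordinal (r_lt2 i).
have F0 i : 0 <= F i by rewrite addr_ge0.
have S : \sum_i F (f i) + \sum_i F (g i) <= \sum_i F i.
  have -> : \sum_i F (f i) = \sum_(i in f @: [set: 'I_r]%SET) F i.
    rewrite big_imset/= => [|i j _ _ [] /ord_inj//].
    by apply: eq_bigl => i; rewrite inE.
  have -> : \sum_i F (g i) = \sum_(i in g @: [set: 'I_r]%SET) F i.
    rewrite big_imset/= => [|i j _ _ [] /addIn /ord_inj//].
    by apply: eq_bigl => i; rewrite inE.
  have dis : [disjoint f @: [set: 'I_r]%SET & g @: [set: 'I_r]%SET].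
    rewrite finset.disjoints_subset; apply/fintype.subsetP => _ /imsetP[i _ ->].
    rewrite inE; apply/imsetP => -[j _ /(congr1 val)/=].
    by have := ltn_ord i; lia.
  rewrite -bigU//= [leRHS](bigID [in [predU f @: [set: 'I_r]%SET & g @: [set: 'I_r]%SET]])/=.
  by rewrite lerDl sumr_ge0.
apply: le_trans S; rewrite -big_split/=.
apply: (@le_trans _ _ (\sum_(i < r) u / 4)).
  rewrite sumr_const card_ord -[leRHS]mulr_natr.
  have H : N%:R <= 25 / 4 * r%:R :> R.
    have : (4 * N <= 25 * r)%N by rewrite /r; lia.
    by rewrite -(ler_nat R) !natrM; lra.
  by have := ler_wpM2l u0 H; lra.
apply: ler_sum => i _.
have ag : a (f i) + 4^-1 <= a (g i).
  rewrite /a !ap_tensor_sum2 //; try exact: ap_int_sym; try exact: ap_int_neq.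
  rewrite -/(int_count (f i)) -/(int_count (g i)).
  have := @int_count_gap N (f i) (g i); rewrite /= leq_addr => /(_ isT).
  rewrite addKn => H; have {H} : (4 * int_count (f i) + N <= 4 * int_count (g i))%N.
    by have := H _; rewrite /r; have := ltn_ord i; rewrite /r; lia.
  rewrite -(ler_nat R) natrD !natrM => H.
  by rewrite ler_pdivlMr// mulrDl divfK ?lt0r_neq0//; lra.
move: (ler_wpM2l u0 ag); rewrite /F {F0 F ag}.
move: (a (f i)) (a (g i)) (m (f i)) (m (g i)) => af ag mf mg {r_lt r_lt2 f g i r a m N0}.
have := ler_norm (mg - t); have := ler_norm (- (mf - t)).
have := ler_norm (- (mg - u * ag)); have := ler_norm (mf - u * af).
by rewrite !normrN; lra.
Qed.

Local Open Scope classical_set_scope.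

Lemma int_T_vanishing : exists2 c : R, 0 < c &
  vanishing (@A_int R) beta h (fun N => [set x | T_stat (@A_int R N) x < c]).
Proof.
have e0 := int_eta_gt0; set eta := int_eta in e0.
exists (eta ^+ 2); first by rewrite exprn_gt0.
(* For [N >= 100], small [T_N] forces a large gap: otherwise [local_field_flat] and
   [A_int_flat_spread] are incompatible. *)
apply: (@vanishing_near _ _ _ _ _ (fun N =>
  [set x | eta ^+ 2 * N%:R <= \sum_i fixed_pt_gap (@A_int R N) beta h x i ^+ 2])); last first.
  apply: (@vanishing_gap _ _ 4%:R); last by rewrite exprn_gt0.
  by move=> N; exact: regular_A_int.
exists 100%N => // N /= N100 x /= Tx; rewrite leNgt; apply/negP => gapx.
have N0 : 0 < N%:R :> R by rewrite ltr0n; lia.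
have hA := @regular_A_int R N.
set A := @A_int R N in hA Tx gapx.
set t := mean_field A x.
have t01 : 0 <= t <= 4.
  rewrite /t /mean_field mulr_ge0 ?invr_ge0 ?sumr_ge0//= => [|i _]; last first.
    by case/andP: (local_field01 hA x i).
  rewrite ler_pdivrMl// (le_trans (ler_sum _ (fun i _ => proj2 (andP (local_field01 hA x i)))))//.
  by rewrite sumr_const card_ord mulr_natl.
set p := sig (beta * t + h).
have S1 : \sum_i `|local_field A x i - t| <= 2 * eta * N%:R.
  apply: sum_norm_le_sqr => //; apply: ltW.
  by move: Tx; rewrite /T_stat mulrC ltr_pdivrMr.
have S2 : \sum_i `|fixed_pt_gap A beta h x i| <= 2 * eta * N%:R.
  by apply: sum_norm_le_sqr => //; exact: ltW.
have S3 := local_field_flat hA x (erefl p).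
have S4 := @A_int_flat_spread N (p ^+ 2) t N100 (sqr_ge0 _) (local_field A x).
have p1 : sig (- (`|beta| * 4 + `|h|)) ^+ 2 <= p ^+ 2.
  rewrite ler_pXn2r ?nnegrE ?sig_ge0//; apply: sig_homo.
  have := ler_norm (- (beta * t)); have := ler_norm (- h).
  rewrite !normrN normrM (ger0_norm (x := t)); last by case/andP: t01.
  have /andP[t0 t4] := t01; have := ler_wpM2l (normr_ge0 beta) t4; lra.
have e : sig (- (`|beta| * 4 + `|h|)) ^+ 2 = eta * (200 * (1 + 4 * `|beta|)).
  rewrite /eta /int_eta divfK// mulf_neq0// lt0r_neq0// ltr_wpDr// mulr_ge0//.
have b0 : 0 <= 2 * 4%:R * `|beta| by rewrite !mulr_ge0.
have S5 := ler_wpM2l b0 S1.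
have S6 : eta * (200 * (1 + 4 * `|beta|)) * N%:R <= p ^+ 2 * N%:R.
  by rewrite ler_wpM2r ?ler0n// -e.
have en : 0 < eta * N%:R by rewrite mulr_gt0.
have enb : 0 <= eta * N%:R * `|beta| by rewrite mulr_ge0// ltW.
rewrite -/A in S4.
lra.
Qed.

End IntModel.

(** * Progressions in the cyclic group *)

Lemma ap_cyc_sym N (a b c : 'I_N) : ap_cyc a b c = ap_cyc c b a.
Proof.
rewrite /ap_cyc (addnC a c) (eq_sym a b) (eq_sym b c) (eq_sym a c).
by case: (b == a); case: (c == b).
Qed.

Lemma ap_cyc_neq N (a b c : 'I_N) : ap_cyc a b c -> [&& a != b, b != c & a != c].
Proof. by case/and4P => -> -> ->. Qed.

(** Reads the congruence in the additive group on ['I_n.+1], where sums can be reindexed by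
    translations. *)
Lemma ap_cycE n (a b c : 'I_n.+1) :
  ap_cyc a b c = [&& a != b, b != c, a != c & a + c == b + b].
Proof.
rewrite /ap_cyc; congr [&& _, _, _ & _].
by rewrite -val_eqE /= mul2n addnn.
Qed.

Lemma sum_eq1 (I : finType) (a : I) : (\sum_b (b == a) = 1)%N.
Proof.
by rewrite (bigD1 a)//= eqxx big1// => b /negPf ->.
Qed.

(** * Counting cyclic progressions through a site *)

Section CycCount.
Variable n : nat.
Notation N := n.+1.
Implicit Types a b c : 'I_N.

(** A solution [b] is determined by the quotient of [m * b] by [N], which takes fewer than [m + 1]
    values. *)
Lemma sum_mulrn_eq m a : (0 < m)%N -> (\sum_b (b *+ m == a) <= m)%N.
Proof.
move=> m0; have valE b : val (b *+ m) = (m * b %% N)%N.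
  elim: m {m0} => [|m IH]; first by rewrite mulr0n mul0n mod0n.
  by rewrite mulrS /= IH modnDmr mulSn.
rewrite -(big_mkcond (fun b => b *+ m == a) (fun=> 1%N)) sum1_card.
case: m m0 valE => // m _ valE.
rewrite -[X in (_ <= X)%N]card_ord.
pose f b : 'I_m.+1 := inord (m.+1 * b %/ N).
apply: (@leq_card_in _ _ f) => b b'; rewrite !unfold_in => /eqP e /eqP e' /(congr1 val).
have lt (c : 'I_N) : (m.+1 * c %/ N < m.+1)%N.
  by rewrite ltn_divLR// ltn_pmul2l.
rewrite /f /= !inordK// => q.
have r : (m.+1 * b %% N = m.+1 * b' %% N)%N by rewrite -!valE e e'.
have : (m.+1 * b = m.+1 * b')%N by rewrite (divn_eq (m.+1 * b) N) q r -divn_eq.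
by move=> /eqP; rewrite eqn_pmul2l// => /eqP /val_inj.
Qed.

(** The linear equation alone, degenerate solutions included, so that its solutions can be counted
    exactly. *)
Definition mid a b c : bool := a + c == b + b.

Lemma mid_sym a b c : mid a b c = mid c b a.
Proof. by rewrite /mid addrC. Qed.

Lemma mid_last a b c : mid a b c = (c == b + b - a).
Proof. by rewrite /mid addrC eq_sym -subr_eq eq_sym. Qed.

Lemma ap_cyc_mid a b c : ap_cyc a b c = mid a b c && (a != c).
Proof.
rewrite ap_cycE -/(mid a b c); case: (eqVneq a b) => [->|ab] /=.
  by rewrite mid_last addrK eq_sym andbN.
case: (eqVneq b c) => [->|bc] /=; last by rewrite andbC.
by rewrite mid_sym mid_last addrK andbN.
Qed.

Lemma sum_mid_last a b : (\sum_c mid a b c = 1)%N.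
Proof.
by rewrite -(sum_eq1 (b + b - a)); apply: eq_bigr => c _; rewrite mid_last.
Qed.

Lemma sum_mid_middle a c : (\sum_b mid a b c <= 2)%N.
Proof.
apply: leq_trans (sum_mulrn_eq (a + c) (isT : 0 < 2)%N); apply: leq_sum => b _.
by rewrite /mid mulr2n eq_sym.
Qed.

(** One choice of [c] for each of its two outer roles, and up to two midpoints when [N] is even. *)
Lemma cyc_sum_le4 a b :
  (\sum_c [|| ap_cyc a b c, ap_cyc b a c | ap_cyc a c b] <= 4)%N.
Proof.
apply: (@leq_trans (\sum_c (mid a b c + (mid b a c + mid a c b)))%N).
  apply: leq_sum => c _; rewrite !ap_cyc_mid.
  by case: (mid a b c); case: (mid b a c); case: (mid a c b); do ?case: (_ == _).
rewrite !big_split/= !sum_mid_last !add1n !ltnS; exact: sum_mid_middle.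
Qed.

Definition cyc_count a : nat :=
  (\sum_b \sum_c [|| ap_cyc a b c, ap_cyc b a c | ap_cyc a c b])%N.

(** Error term in replacing progressions by solutions of [mid]: coincidences of two roles, and
    degenerate solutions. *)
Definition overlap a b c : nat :=
  ((mid a b c && mid b a c) + ((mid a b c && mid a c b) +
   ((mid b a c && mid a c b) + ((mid a b c && (a == c)) +
   ((mid b a c && (b == c)) + (mid a c b && (a == b)))))))%N.

(** Two roles at once force [3 b = 3 a], a degenerate solution forces [2 b = 2 a] or [2 c = 2 a];
    the other index is then determined. The total is three times 3 plus three times 2. *)
Lemma sum_overlap a : (\sum_b \sum_c overlap a b c <= 15)%N.
Proof.
have bnd (m : nat) (P : 'I_N -> 'I_N -> bool) (Q : 'I_N -> 'I_N) : (0 < m)%N ->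
  (forall b c, P b c -> b *+ m = a *+ m /\ c = Q b) ->
  (\sum_b \sum_c P b c <= m)%N.
  move=> m0 H; apply: leq_trans (sum_mulrn_eq (a *+ m) m0).
  apply: leq_sum => b _; case: eqP => [_|bm] /=.
    by apply: sum_le1 => c c' /H[_ ->] /H[_ ->].
  by rewrite big1// => c _; apply/eqP; rewrite eqb0; apply/negP => /H[].
have three (b c : 'I_N) : mid a b c -> mid b a c -> b *+ 3 = a *+ 3.
  rewrite /mid => /eqP e1 /eqP e2; rewrite !mulrS mulr0n !addr0 -e1 -e2.
  by rewrite addrCA.
have three' (b c : 'I_N) : mid a b c -> mid a c b -> b *+ 3 = a *+ 3.
  rewrite /mid => /eqP e1 /eqP e2.
  have e : a + a = b + c by apply: (addIr b); rewrite -addrA e2 addrA e1 addrAC.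
  by rewrite !mulrS mulr0n !addr0 e addrCA e1.
have three'' (b c : 'I_N) : mid b a c -> mid a c b -> b *+ 3 = a *+ 3.
  rewrite /mid => /eqP e1 /eqP e2.
  have e : b + b = a + c.
    by apply: (addIr c); rewrite -[RHS]addrA -e2 -addrA e1 addrA (addrC b) -addrA (addrC b).
  by rewrite !mulrS mulr0n !addr0 e addrCA e1.
rewrite /overlap; under eq_bigr do rewrite !big_split/=.
rewrite !big_split/=.
apply: (@leq_trans (3 + (3 + (3 + (2 + (2 + 2)))))) => //.
apply: leq_add.
  apply: (bnd 3%N _ (fun b => b + b - a)) => // b c /andP[m1 m2].
  by split; [exact: three m1 m2 | apply/eqP; rewrite -mid_last].
apply: leq_add.
  apply: (bnd 3%N _ (fun b => b + b - a)) => // b c /andP[m1 m2].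
  by split; [exact: three' m1 m2 | apply/eqP; rewrite -mid_last].
apply: leq_add.
  apply: (bnd 3%N _ (fun b => a + a - b)) => // b c /andP[m1 m2].
  by split; [exact: three'' m1 m2 | apply/eqP; rewrite -mid_last].
apply: leq_add.
  apply: (bnd 2%N _ (fun b => a)) => // b c /andP[/eqP m1 /eqP e]; split => //.
  by rewrite !mulr2n -m1 -e.
apply: leq_add.
  apply: (bnd 2%N _ (fun b => b)) => // b c /andP[/eqP m1 /eqP e]; split => //.
  by rewrite !mulr2n -m1 -e.
rewrite exchange_big.
apply: (bnd 2%N _ (fun c => a)) => // b c /andP[/eqP m1 /eqP e]; split => //.
by rewrite !mulr2n -m1 -e.
Qed.

Lemma mid_overlap a b c : (mid a b c + (mid b a c + mid a c b) <=
  [|| ap_cyc a b c, ap_cyc b a c | ap_cyc a c b] + overlap a b c)%N.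
Proof.
rewrite /overlap !ap_cyc_mid.
case: (mid a b c); case: (mid b a c); case: (mid a c b) => //=;
  by case: (a == c); case: (b == c); case: (a == b).
Qed.

Lemma overlap_mid a b c : ([|| ap_cyc a b c, ap_cyc b a c | ap_cyc a c b] <=
  mid a b c + (mid b a c + mid a c b))%N.
Proof.
rewrite !ap_cyc_mid.
case: (mid a b c); case: (mid b a c); case: (mid a c b) => //=;
  by case: (a == c); case: (b == c); case: (a == b).
Qed.

(** For each role the linear equation has exactly [N] solutions [(b, c)]. *)
Lemma cyc_countE a : (cyc_count a <= 3 * N <= cyc_count a + 15)%N.
Proof.
have E : (\sum_b \sum_c (mid a b c + (mid b a c + mid a c b)) = 3 * N)%N.
  under eq_bigr do rewrite big_split big_split/= !sum_mid_last.
  rewrite !big_split/= exchange_big/=.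
  under [X in (_ + (_ + X))%N]eq_bigr do rewrite sum_mid_last.
  by rewrite !sum_nat_const card_ord; lia.
rewrite -E; apply/andP; split.
  by apply: leq_sum => b _; apply: leq_sum => c _; exact: overlap_mid.
apply: leq_trans (leq_add (leqnn _) (sum_overlap a)).
rewrite -big_split/=; apply: leq_sum => b _; rewrite -big_split/=.
by apply: leq_sum => c _; exact: mid_overlap.
Qed.

(* With [G i = #{d | x (i + 2d)}], the count is [sum_i x_i G_i], and the
   invariance [G (i + 2d) = G i] turns it into the mean of [G ^ 2]. *)
Lemma sum_mid_middle_ge (R : realType) (x : 'I_N -> R) :
  (\sum_i x i) ^+ 2 <= \sum_a \sum_b \sum_c (mid b a c)%:R * x b * x c.
Proof.
set s := \sum_i x i; pose G a := \sum_d x (a + (d + d)).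
have GI a d : G (a + (d + d)) = G a.
  rewrite /G (reindex_inj (addIr (- d))); apply: eq_bigr => e _.
  by rewrite -addrA addrACA (addrC d) subrK.
have sG : \sum_a G a = N%:R * s.
  rewrite /G exchange_big/= -[X in X%:R](card_ord N) mulr_natl -sumr_const.
  by apply: eq_bigr => d _; rewrite /s [RHS](reindex_inj (addIr (d + d))).
have E : \sum_a \sum_b \sum_c (mid b a c)%:R * x b * x c = \sum_a x a * G a.
  transitivity (\sum_a \sum_d x (a - d) * x (a + d)).
    apply: eq_bigr => a _; rewrite (reindex_inj (subrI a)).
    apply: eq_bigr => d _; rewrite (bigD1 (a + d))//= big1 ?addr0 => [|c cd].
      by rewrite /mid addrACA addNr addr0 eqxx mul1r.
    rewrite mid_last opprB addrACA subrr addr0 (negPf cd).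
    by rewrite !mul0r.
  rewrite exchange_big/=.
  transitivity (\sum_d \sum_a x a * x (a + (d + d))).
    apply: eq_bigr => d _; rewrite (reindex_inj (addIr d)); apply: eq_bigr => a _.
    by rewrite addrK addrA.
  by rewrite exchange_big; apply: eq_bigr => a _; rewrite mulr_sumr.
have E2 : N%:R * \sum_a x a * G a = \sum_a G a ^+ 2.
  rewrite -[X in X%:R](card_ord N) mulr_natl -sumr_const.
  transitivity (\sum_(d : 'I_N) \sum_a x (a + (d + d)) * G a).
    apply: eq_bigr => d _; rewrite (reindex_inj (addIr (d + d))).
    by apply: eq_bigr => a _; rewrite GI.
  by rewrite exchange_big; apply: eq_bigr => a _; rewrite -mulr_suml expr2.
rewrite E -(ler_pM2l (ltr0Sn R n)) E2.
(* [G] has mean [s], so its mean square is at least [s ^+ 2]. *)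
have : 0 <= \sum_a (G a - s) ^+ 2 by apply: sumr_ge0 => a _; exact: sqr_ge0.
have -> : \sum_a (G a - s) ^+ 2 = \sum_a G a ^+ 2 - 2 * s * (N%:R * s) + N%:R * s ^+ 2.
  have -> : N%:R * s ^+ 2 = \sum_(a : 'I_N) s ^+ 2.
    by rewrite sumr_const card_ord mulr_natl.
  rewrite -sG mulr_sumr -sumrB -big_split/=.
  by apply: eq_bigr => a _; ring.
lra.
Qed.

End CycCount.

Lemma regular_A_cyc (R : realType) N : regular 4%:R (@A_cyc R N).
Proof.
apply: (ap_regular (@ap_cyc_sym N) (@ap_cyc_neq N)) => a b _.
by case: N a b => [[]|n] a b //; exact: cyc_sum_le4.
Qed.

(** * Weighted sums over cyclic progressions *)

Section CycReal.
Variables (R : realType) (n : nat).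
Notation N := n.+1.
Notation A := (@A_cyc R N).
Implicit Types a b c : 'I_N.

Let N0 : 0 < N%:R :> R. Proof. exact: ltr0Sn. Qed.

Lemma A_cycE a b c :
  A a b c = ([|| ap_cyc a b c, ap_cyc b a c | ap_cyc a c b])%:R / N%:R.
Proof.
by rewrite mulrC /A_cyc forms_apE//; [exact: ap_cyc_sym|exact: ap_cyc_neq].
Qed.

Lemma cyc_bil1 a : 3 - 15 / N%:R <= bil A (fun=> 1) (fun=> 1) a <= 3.
Proof.
rewrite (ap_tensor_sum2 (@ap_cyc_sym N) (@ap_cyc_neq N)) -/(cyc_count a).
have /andP[c1 c2] := cyc_countE a.
move: c1 c2; rewrite -2!(ler_nat R) natrD natrM => c1 c2.
apply/andP; split; last by rewrite ler_pdivrMr.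
by rewrite lerBlDr -mulrDl ler_pdivlMr.
Qed.

Lemma sum_mid_R (u v : 'I_N -> R) :
  \sum_a \sum_b \sum_c (mid a b c)%:R * u a * v b = (\sum_a u a) * (\sum_b v b).
Proof.
rewrite mulr_suml; apply: eq_bigr => a _; rewrite mulr_sumr.
apply: eq_bigr => b _; transitivity (\sum_c (mid a b c)%:R * (u a * v b)).
  by apply: eq_bigr => c _; rewrite mulrA.
by rewrite -mulr_suml -natr_sum sum_mid_last mul1r.
Qed.

Lemma sum_mid_R' (v w : 'I_N -> R) :
  \sum_a \sum_b \sum_c (mid a b c)%:R * v b * w c = (\sum_b v b) * (\sum_c w c).
Proof.
rewrite mulrC -sum_mid_R exchange_big/=; under eq_bigr do rewrite exchange_big/=.
rewrite exchange_big; apply: eq_bigr => a _; apply: eq_bigr => b _.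
by apply: eq_bigr => c _; rewrite mid_sym mulrAC.
Qed.

(** The two roles with [a] at an end give exactly the square of the number of ones, the middle role
    at least that by [sum_mid_middle_ge]; overlaps cost at most 15 per site. *)
Lemma cyc_mean_field_ge (x : config N) :
  3 * (N%:R^-1 * \sum_i ind R x i) ^+ 2 - 15 / N%:R <= mean_field A x.
Proof.
set s := \sum_i ind R x i; set X := ind R x.
have E : mean_field A x = N%:R^-1 * (N%:R^-1 * \sum_a \sum_b \sum_c
  ([|| ap_cyc a b c, ap_cyc b a c | ap_cyc a c b])%:R * X b * X c).
  rewrite /mean_field; congr (_ * _); rewrite mulr_sumr; apply: eq_bigr => a _.
  rewrite mulr_sumr; apply: eq_bigr => b _; rewrite mulr_sumr.
  by apply: eq_bigr => c _; rewrite A_cycE -/(X b) /X /ind; ring.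
have H : \sum_a \sum_b \sum_c ((mid a b c)%:R * X b * X c +
    ((mid b a c)%:R * X b * X c + (mid a c b)%:R * X b * X c))
  <= \sum_a \sum_b \sum_c (([|| ap_cyc a b c, ap_cyc b a c | ap_cyc a c b])%:R * X b * X c
     + (overlap a b c)%:R).
  apply: ler_sum => a _; apply: ler_sum => b _; apply: ler_sum => c _.
  have := mid_overlap a b c; move: (overlap a b c) => ov.
  rewrite -(ler_nat R) !natrD; have : 0 <= ov%:R :> R by [].
  rewrite /X /ind; case: (x b); case: (x c); rewrite /= ?mulr1 ?mulr0; lra.
move: H; under eq_bigr do under eq_bigr do rewrite !big_split/=.
under eq_bigr do rewrite !big_split/=; rewrite !big_split/= sum_mid_R'.
under [X in _ <= X]eq_bigr do under eq_bigr do rewrite !big_split/=.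
under [X in _ <= X]eq_bigr do rewrite !big_split/=; rewrite big_split/=.
have -> : \sum_a \sum_b \sum_c (mid a c b)%:R * X b * X c = s * s.
  rewrite -sum_mid_R'; apply: eq_bigr => a _; rewrite exchange_big/=.
  by apply: eq_bigr => c _; apply: eq_bigr => b _; ring.
rewrite -/s => H.
have H2 := sum_mid_middle_ge X; rewrite -/s in H2.
have H3 : \sum_(a < N) \sum_(b < N) \sum_(c < N) (overlap a b c)%:R <= 15 * N%:R :> R.
  apply: (@le_trans _ _ (\sum_(a < N) (15 : R))).
    apply: ler_sum => a _; have := sum_overlap a; rewrite -(ler_nat R) natr_sum.
    by under eq_bigr do rewrite natr_sum.
  by rewrite sumr_const card_ord mulr_natr.
rewrite E; set S := \sum_a _ in H *.
have H4 : 3 * s ^+ 2 - 15 * N%:R <= S by lra.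
have -> : 3 * (N%:R^-1 * s) ^+ 2 - 15 / N%:R =
  N%:R^-1 * (N%:R^-1 * (3 * s ^+ 2 - 15 * N%:R)).
  by field; exact: lt0r_neq0.
by rewrite !ler_pM2l ?invr_gt0.
Qed.

(** * Progressions avoiding a block *)

Variable m : nat.
Hypothesis mN : (8 * m <= N)%N.

Definition off_block a : R := (2 * m <= a)%N%:R.

Let g a : R := (a < 2 * m)%N%:R.

Let gE a : off_block a = 1 - g a.
Proof. by rewrite /off_block /g ltnNge; case: leqP; rewrite ?subrr ?subr0. Qed.

Let sum_g : \sum_a g a = 2 * m%:R.
Proof.
rewrite -natr_sum sum_lt_ord -natrM; congr (_%:R); lia.
Qed.

Lemma sum_off_block : \sum_a off_block a = N%:R - 2 * m%:R.
Proof.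
under eq_bigr do rewrite gE; rewrite sumrB sum_g; congr (_ - _).
by rewrite sumr_const card_ord.
Qed.

Let sum_parity (e : bool) M :
  (\sum_(c < M) ((c < 2 * m) && (odd c == e)) =
   if e then (minn M (2 * m))./2 else uphalf (minn M (2 * m)))%N.
Proof.
elim: M => [|M IH]; first by rewrite big_ord0 min0n; case: e.
by rewrite big_ord_recr/= IH; case: e {IH}; lia.
Qed.

(** Inside the short block [a + c] does not wrap around, so a midpoint outside the block must
    satisfy [2 b = a + c + N]; this fixes [b] and the parity of [c]. *)
Let mid_block a c : (a < 2 * m)%N -> (c < 2 * m)%N ->
  (\sum_b (mid a b c && (2 * m <= b)) <= (odd c == odd (N + a)))%N.
Proof.
move=> am cm.
have key b : mid a b c && (2 * m <= b)%N -> (2 * b = a + c + N)%N.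
  rewrite /mid -val_eqE/= => /andP[/eqP e mb]; move: e.
  rewrite modn_small; last lia.
  case: (ltnP (b + b) N) => bN; first by rewrite modn_small//; lia.
  have := ltn_ord b => bN'.
  rewrite -(subnK bN) modnDr modn_small; lia.
case: eqP => [_|H].
  by apply: sum_le1 => b b' /key e /key e'; apply: val_inj => /=; lia.
rewrite big1// => b _; apply/eqP; rewrite eqb0; apply/negP => /key e.
by apply: H; lia.
Qed.

(** Inclusion-exclusion over the block. A constant density of the same mass would have
    [12 m^2 - 8 m^3 / N] in place of [10 m^2]. *)
Lemma cyc_tri_off_block : tri A off_block off_block off_block <=
  3 / N%:R * (N%:R ^+ 2 - 6 * m%:R * N%:R + 10 * m%:R ^+ 2).
Proof.
set f := off_block.
pose Q := \sum_a \sum_b \sum_c (mid a b c)%:R * f a * f b * f c.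
have f01 a : 0 <= f a by rewrite /f /off_block.
have H1 : tri A f f f <= 3 / N%:R * Q.
  have -> : 3 / N%:R * Q = N%:R^-1 * (Q + (Q + Q)) by ring.
  have Q2 : Q = \sum_a \sum_b \sum_c (mid b a c)%:R * f a * f b * f c.
    rewrite /Q exchange_big; apply: eq_bigr => a _; apply: eq_bigr => b _.
    by apply: eq_bigr => c _; ring.
  have Q3 : Q = \sum_a \sum_b \sum_c (mid a c b)%:R * f a * f b * f c.
    rewrite /Q; apply: eq_bigr => a _; rewrite exchange_big; apply: eq_bigr => b _.
    by apply: eq_bigr => c _; ring.
  rewrite [X in _ * (_ + (X + _))]Q2 [X in _ * (_ + (_ + X))]Q3 /Q -!big_split/= mulr_sumr; apply: ler_sum => a _.
  rewrite -!big_split/= mulr_sumr; apply: ler_sum => b _.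
  rewrite -!big_split/= mulr_sumr; apply: ler_sum => c _.
  rewrite A_cycE -!mulrDl [_ / _]mulrC -[leLHS]mulrA -[leLHS]mulrA -[leLHS]mulrA.
  rewrite ler_pM2l ?invr_gt0// !mulrA !ler_wpM2r// -!natrD ler_nat.
  exact: overlap_mid.
apply: (le_trans H1); rewrite ler_pM2l ?divr_gt0//.
(* The terms in [g a * g c] and [g a * g b * g c] are merged into the last one, which carries
   [f b]. *)
have E : Q = \sum_a \sum_b \sum_c ((mid a b c)%:R * 1 * 1 - (mid a b c)%:R * g a * 1
  - (mid a b c)%:R * 1 * g b - (mid a b c)%:R * 1 * g c + (mid a b c)%:R * g a * g b
  + (mid a b c)%:R * g b * g c + (mid a b c)%:R * f b * g a * g c).
  apply: eq_bigr => a _; apply: eq_bigr => b _; apply: eq_bigr => c _.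
  by rewrite /f !gE; ring.
(* By parity only half of the [4 m^2] pairs in the block can have a midpoint outside it. *)
have L : \sum_a \sum_b \sum_c (mid a b c)%:R * f b * g a * g c <= 2 * m%:R ^+ 2.
  under eq_bigr do rewrite exchange_big/=.
  apply: (@le_trans _ _ (\sum_a g a * m%:R)); last first.
    by rewrite -mulr_suml sum_g; lra.
  apply: ler_sum => a _; rewrite /g.
  case: (ltnP a (2 * m)) => am; last first.
    by rewrite mul0r big1// => c _; rewrite big1// => b _; rewrite mulr0 mul0r.
  rewrite mul1r; apply: (@le_trans _ _
    (\sum_(c < N) ((c < 2 * m) && (odd c == odd (N + a)))%N)%:R); last first.
    rewrite ler_nat sum_parity; case: ifP => _; lia.
  rewrite natr_sum; apply: ler_sum => c _.
  case: (ltnP c (2 * m)) => cm /=; last by rewrite big1// => b _; rewrite mulr0.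
  have := mid_block am cm; rewrite -(ler_nat R) natr_sum; apply: le_trans.
  apply: ler_sum => b _; rewrite !mulr1 /f /off_block.
  by case: (mid a b c); case: (leqP (2 * m) b); rewrite /= ?mulr0 ?mulr1 ?mul0r.
move: L; rewrite E; set LL := \sum_a _ => HL.
under eq_bigr do under eq_bigr do rewrite !(big_split, sumrN)/=.
under eq_bigr do rewrite !(big_split, sumrN)/=; rewrite !(big_split, sumrN)/=.
rewrite -/LL !sum_mid_R !sum_mid_R'.
have -> : \sum_(a : 'I_N) 1 = N%:R :> R by rewrite sumr_const card_ord.
rewrite sum_g; lra.
Qed.

End CycReal.

(** * The cyclic model with positive interaction *)

Section Envelope.
Variables (R : realType) (N : nat) (A : tensor R N) (D : R).
Hypothesis hA : regular D A.
Variables (beta h a d : R) (x : config N).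
Hypothesis beta0 : 0 <= beta.
Hypothesis d0 : 0 <= d.
Hypothesis rowA : forall i, a - d <= bil A (fun=> 1) (fun=> 1) i <= a.

Let m := local_field A x.
Let b := cmean A beta h x.
Let step t := a * sig (beta * t + h) ^+ 2.
Let gap_sum := \sum_i `|fixed_pt_gap A beta h x i|.

Lemma bil_lel v v' w i : (forall j, v j <= v' j) -> (forall j, 0 <= w j) ->
  bil A v w i <= bil A v' w i.
Proof.
move=> vv w0; apply: ler_sum => j _; apply: ler_sum => k _.
by rewrite ler_wpM2r// ler_wpM2l// (tensor_ge0 hA).
Qed.

Let bil_cst s i : bil A (fun=> s) (fun=> s) i = s ^+ 2 * bil A (fun=> 1) (fun=> 1) i.
Proof.
rewrite /bil mulr_sumr; apply: eq_bigr => j _; rewrite mulr_sumr.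
by apply: eq_bigr => k _; ring.
Qed.

Let bil_pos (r : 'I_N -> R) (s : R) i : (forall j, 0 <= r j) -> 0 <= s <= 1 ->
  bil A (fun j => beta * r j) (fun j => b j + s) i <=
  2 * beta * D / N%:R * \sum_j r j.
Proof.
move=> r0 s01.
have H j : 0 <= b j + s <= 2.
  by have := cmean01 A beta h x j; rewrite -/b; lra.
apply: (le_trans (ler_norm _)); apply: (le_trans (bil_norm_le hA _ _ H)).
rewrite le_eqVlt; apply/orP; left; apply/eqP.
have -> : \sum_j `|beta * r j| = beta * \sum_j r j.
  by rewrite mulr_sumr; apply: eq_bigr => j _; rewrite ger0_norm// mulr_ge0.
by ring.
Qed.

Let sum_const (c : R) : \sum_(i < N) c / N%:R <= `|c|.
Proof.
rewrite sumr_const card_ord -[leLHS]mulr_natr; case: (posnP N) => N0.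
  by rewrite [X in _ * X](_ : _ = 0) ?mulr0// N0.
by rewrite divfK ?ler_norm// pnatr_eq0 -lt0n.
Qed.

(** As [beta >= 0], the conditional means exceed [sig (beta t + h)] by at most [beta] times the
    excess of [m] over [t]. Positivity of [A] carries the one-sided bound through [bil]. *)
Lemma upper_envelope t : \sum_i Num.max 0 (m i - step t) <=
  gap_sum + 2 * beta * D * \sum_i Num.max 0 (m i - t).
Proof.
case: (pickP 'I_N) => [i0 _|no]; last first.
  by rewrite /gap_sum !big1 ?mulr0 ?addr0// => i _; have := no i; rewrite inE.
have D0 := regular_ge0 hA i0.
set s := sig (beta * t + h); pose r j := Num.max 0 (m j - t).
have r0 j : 0 <= r j by rewrite le_max lexx.
have sr0 : 0 <= \sum_j r j by apply: sumr_ge0.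
have s01 : 0 <= s <= 1 by rewrite sig_ge0 sig_le1.
have br j : b j - s <= beta * r j.
  rewrite lerBlDl (le_trans (sig_lip_pos (beta * t + h) _))// lerD2l.
  rewrite ge_max mulr_ge0//= opprD addrACA subrr addr0 -mulrBr ler_wpM2l//.
  by rewrite le_max lexx orbT.
set c := 2 * beta * D * \sum_j r j.
have c0 : 0 <= c by rewrite !mulr_ge0.
apply: (@le_trans _ _ (\sum_i (`|fixed_pt_gap A beta h x i| + c / N%:R))); last first.
  by rewrite big_split/= lerD2l (le_trans (sum_const c))// ger0_norm.
apply: ler_sum => i _; rewrite ge_max addr_ge0 ?divr_ge0//=.
have -> : m i = fixed_pt_gap A beta h x i + bil A b b i by rewrite subrK.
rewrite -addrA lerD ?ler_norm//.
have /andP[_ ai] := rowA i.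
have h1 : bil A (fun=> s) (fun=> s) i <= step t.
  by rewrite bil_cst mulrC ler_wpM2r// sqr_ge0.
apply: (@le_trans _ _ (bil A b b i - bil A (fun=> s) (fun=> s) i)).
  by rewrite lerD2l lerN2.
rewrite (bil_sqB hA); apply: (@le_trans _ _
   (bil A (fun j => beta * r j) (fun j => b j + s) i)).
  apply: bil_lel => // j; have := cmean01 A beta h x j; rewrite -/b; lra.
apply: (le_trans (bil_pos i r0 s01)); rewrite /c; lra.
Qed.

(** The mirror image; the term [d * N] pays for row sums below [a]. *)
Lemma lower_envelope t : \sum_i Num.max 0 (step t - m i) <=
  gap_sum + d * N%:R + 2 * beta * D * \sum_i Num.max 0 (t - m i).
Proof.
case: (pickP 'I_N) => [i0 _|no]; last first.
  rewrite big1 => [|i _]; last by have := no i; rewrite inE.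
  have -> : \sum_i Num.max 0 (t - m i) = 0.
    by rewrite big1// => i _; have := no i; rewrite inE.
  by rewrite mulr0 addr0 addr_ge0 ?mulr_ge0 ?sumr_ge0.
have D0 := regular_ge0 hA i0.
set s := sig (beta * t + h); pose r j := Num.max 0 (t - m j).
have r0 j : 0 <= r j by rewrite le_max lexx.
have sr0 : 0 <= \sum_j r j by apply: sumr_ge0.
have s01 : 0 <= s <= 1 by rewrite sig_ge0 sig_le1.
have br j : s - b j <= beta * r j.
  rewrite lerBlDl (le_trans (sig_lip_pos (beta * m j + h) _))// lerD2l.
  rewrite ge_max mulr_ge0//= opprD addrACA subrr addr0 -mulrBr ler_wpM2l//.
  by rewrite le_max lexx orbT.
set c := 2 * beta * D * \sum_j r j.
have c0 : 0 <= c by rewrite !mulr_ge0.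
apply: (@le_trans _ _ (\sum_i (`|fixed_pt_gap A beta h x i| + d + c / N%:R))); last first.
  rewrite !big_split/= sumr_const card_ord -[d *+ N]mulr_natr lerD2l.
  by rewrite (le_trans (sum_const c))// ger0_norm.
apply: ler_sum => i _; rewrite ge_max !addr_ge0 ?divr_ge0//=.
have -> : m i = fixed_pt_gap A beta h x i + bil A b b i by rewrite subrK.
have /andP[ai _] := rowA i.
have h1 : step t - d <= bil A (fun=> s) (fun=> s) i.
  rewrite bil_cst /step -/s.
  have s21 : s ^+ 2 <= 1 by rewrite expr_le1; case/andP: s01.
  have := ler_wpM2l (sqr_ge0 s) ai; have := ler_wpM2l d0 s21; lra.
have h2 : bil A (fun=> s) (fun=> s) i - bil A b b i <= c / N%:R.
  rewrite (bil_sqB hA); apply: (@le_trans _ _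
     (bil A (fun j => beta * r j) (fun j => b j + s) i)).
    rewrite [leLHS](eq_bil A (frefl _) (w' := fun j => b j + s)); last first.
      by move=> j; rewrite addrC.
    apply: bil_lel => // j; have := cmean01 A beta h x j; rewrite -/b; lra.
  apply: (le_trans (bil_pos i r0 s01)); rewrite /c; lra.
have := ler_norm (- fixed_pt_gap A beta h x i); rewrite normrN; lra.
Qed.

End Envelope.

(** * The scalar mean-field iteration *)

Section MeanFieldIteration.
Variables (R : realType) (beta h : R).
Hypotheses (beta0 : 0 < beta) (h0 : 0 <= h).

Definition mf_step (t : R) : R := 3 * sig (beta * t + h) ^+ 2.
(** The starting points 4 and 0 bound all local fields, so the envelope errors start at zero. *)
Definition mf_upper k := iter k mf_step 4.
Definition mf_lower k := iter k mf_step 0.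

Lemma mf_step_homo : {homo mf_step : s t / s <= t}.
Proof.
move=> s t st; rewrite /mf_step ler_pM2l// ler_pXn2r ?nnegrE ?sig_ge0//.
by rewrite sig_homo// lerD2r ler_pM2l.
Qed.

Lemma mf_step_bound t : 0 <= mf_step t <= 3.
Proof.
rewrite /mf_step mulr_ge0 ?sqr_ge0//= ler_piMr// expr_le1// ?sig_ge0 ?sig_le1//.
Qed.

Lemma mf_upper_bound k : 0 <= mf_upper k <= 4.
Proof. by case: k => [|k] /=; [|have := mf_step_bound (mf_upper k)]; rewrite /mf_upper/=; lra. Qed.

Lemma mf_lower_bound k : 0 <= mf_lower k <= 4.
Proof. by case: k => [|k] /=; [|have := mf_step_bound (mf_lower k)]; rewrite /mf_lower/=; lra. Qed.

Lemma mf_lower_upper k : mf_lower k <= mf_upper k.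
Proof. by elim: k => [|k IH]; [rewrite /mf_lower/=; lra|exact: mf_step_homo]. Qed.

Lemma mf_upper_noninc : nonincreasing_seq mf_upper.
Proof.
apply/nonincreasing_seqP; elim=> [|k IH]; last exact: mf_step_homo.
by have := mf_step_bound 4; rewrite /mf_upper/=; lra.
Qed.

Lemma mf_lower_nondec : nondecreasing_seq mf_lower.
Proof.
apply/nondecreasing_seqP; elim=> [|k IH]; last exact: mf_step_homo.
by have := mf_step_bound 0; rewrite /mf_lower/=; lra.
Qed.

Lemma sigE (t : R) : sig t * (1 + expR (- t)) = 1.
Proof.
rewrite /sig mulrDr mulr1 mulrAC -expRD subrr expR0 -mulrDl addrC.
by rewrite mulfV// lt0r_neq0// expR1_gt0.
Qed.

(** From [e^y >= (1 + y/2)^2]: the difference of the two sides is at least [1 + (1 - y/2)^2]. *)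
Lemma two_lt_expR (y : R) : 0 <= y -> 2 * y < 1 + expR y.
Proof.
move=> y0; have -> : expR y = expR (y / 2) ^+ 2.
  by rewrite expr2 -expRD; congr expR; field.
have H := expR_ge1Dx (y / 2).
have : (1 + y / 2) ^+ 2 <= expR (y / 2) ^+ 2.
  by rewrite ler_pXn2r ?nnegrE ?expR_ge0// addr_ge0// divr_ge0.
have := sqr_ge0 (1 - y / 2).
have -> : (1 - y / 2) ^+ 2 = 1 - y + y ^+ 2 / 4 by field.
have -> : (1 + y / 2) ^+ 2 = 1 + y + y ^+ 2 / 4 by field.
lra.
Qed.

Let f (y : R) := y * ((1 + expR (- y)) * (1 + expR (- y))).

Let f_derive (y : R) : is_derive y 1 f
  ((1 + expR (- y)) * (1 + expR (- y)) -
   2 * y * (1 + expR (- y)) * expR (- y)).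
Proof.
have H1 : is_derive y 1 (fun y : R => 1 + expR (- y)) (- expR (- y)).
  have H := @is_derive1_comp R expR (fun y => - y) y _ _
    (is_derive_expR (- y)) (is_deriveNid y 1).
  by apply: is_derive_eq; rewrite add0r mul1r mulrN1.
have H2 := is_deriveM H1 H1.
have H3 := is_deriveM (is_derive_id y (1 : R)) H2.
set g := fun y : R => 1 + expR (- y) in H1 H2 H3 *.
have -> : (1 + expR (- y)) * (1 + expR (- y)) - 2 * y * (1 + expR (- y)) * expR (- y) =
  y *: (g y *: - expR (- y) + g y *: - expR (- y)) + (g y * g y)%:A.
  by rewrite /GRing.scale/= /g; ring.
exact: H3.
Qed.

(** With [e = e^-t] the derivative is [(1 + e) e (1 + e^t - 2 t)], positive by [two_lt_expR]. *)
Let f_lt y z : 0 <= y -> y < z -> f y < f z.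
Proof.
move=> y0 yz; apply: (@gtr0_derive1_lt_cc R f y z) => //.
- move=> t; rewrite in_itv/= => /andP[yt _].
  rewrite derive1E; have [_ ->] := f_derive t.
  have t0 : 0 <= t by rewrite (le_trans y0)// ltW.
  set e := expR (- t); have e0 : 0 < e by rewrite expR_gt0.
  have -> : (1 + e) * (1 + e) - 2 * t * (1 + e) * e =
    (1 + e) * e * (1 + e^-1 - 2 * t) by field; exact: lt0r_neq0.
  apply: mulr_gt0; first by rewrite mulr_gt0 ?addr_gt0.
  by rewrite subr_gt0 /e expRN invrK; exact: two_lt_expR.
- apply: derivable_within_continuous => t _; by have [] := f_derive t.
- by rewrite in_itv/= lexx ltW.
- by rewrite in_itv/= lexx ltW.
Qed.

(* [t = 3 sig(beta t + h)^2] says [(y - h) (1 + e^-y)^2 = 3 beta] for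
   [y = beta t + h >= 0], and [y (1 + e^-y)^2] is increasing. *)
Lemma mf_step_fixed_unique l u :
  0 <= l -> l <= u -> mf_step l = l -> mf_step u = u -> l = u.
Proof.
move=> l0 lu fl fu; apply/eqP; move: lu; rewrite le_eqVlt => /orP[//|lu].
have y0 : 0 <= beta * l + h by rewrite addr_ge0// mulr_ge0// ltW.
have yz : beta * l + h < beta * u + h by rewrite ltrD2r ltr_pM2l.
have F t : mf_step t = t -> f (beta * t + h) =
  3 * beta + h * ((1 + expR (- (beta * t + h))) * (1 + expR (- (beta * t + h)))).
  rewrite /f /mf_step => ft; set y := beta * t + h in ft *.
  have := sigE y; set E := 1 + _ => sE.
  have : t * (E * E) = 3 * (sig y * E) * (sig y * E) by rewrite -{1}ft; ring.
  rewrite sE /y => tE; rewrite mulrDl -mulrA tE; ring.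
have := f_lt y0 yz; rewrite !F// ltrD2l ltNge ler_wpM2l//.
have e : 1 + expR (- (beta * u + h)) <= 1 + expR (- (beta * l + h)).
  by rewrite lerD2l ler_expR lerN2 ltW.
by rewrite ler_pM// addr_ge0// expR_ge0.
Qed.

Local Open Scope classical_set_scope.

Lemma continuous_mf_step : continuous mf_step.
Proof.
have cs : continuous (@sig R).
  move=> t; apply/cvgrPdist_lt => e e0; near=> s.
  apply: (le_lt_trans (sig_lip _ _)); near: s.
  exact: (@cvgr_dist_lt _ _ _ _ _ id t).
move=> t; rewrite /mf_step; apply: cvgM; first exact: cvg_cst.
have H : sig (beta * s + h) @[s --> t] --> sig (beta * t + h).
  apply: (@continuous_cvg _ _ _ _ _ _ (@sig R)); first exact: cs.
  by apply: cvgD; [apply: cvgM; [exact: cvg_cst|exact: cvg_id]|exact: cvg_cst].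
by rewrite expr2; under eq_fun do rewrite expr2; exact: cvgM.
Unshelve. all: by end_near.
Qed.

(** Both sequences are monotone and bounded, and their limits are fixed points, hence equal. *)
Lemma mf_gap_small e : 0 < e -> exists k, mf_upper k - mf_lower k <= e.
Proof.
move=> e0.
have cu : cvgn mf_upper.
  apply: nonincreasing_is_cvgn; first exact: mf_upper_noninc.
  by exists 0 => _ [k _ <-]; case/andP: (mf_upper_bound k).
have cl : cvgn mf_lower.
  apply: nondecreasing_is_cvgn; first exact: mf_lower_nondec.
  by exists 4 => _ [k _ <-]; case/andP: (mf_lower_bound k).
have fixed (w : nat -> R) : (forall k, w k.+1 = mf_step (w k)) -> cvgn w ->
    mf_step (limn w) = limn w.
  move=> wS cw.
  have H1 : (mf_step \o w) @ \oo --> mf_step (limn w).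
    by apply: continuous_cvg; [exact: continuous_mf_step|exact: cw].
  have H2 : (mf_step \o w) @ \oo --> limn w.
    have -> : mf_step \o w = (fun k => w k.+1) by apply/funext => k /=; rewrite wS.
    by rewrite (@cvg_shiftS _ w).
  exact: (cvg_unique _ H1 H2).
have fu := fixed mf_upper (fun k => erefl) cu.
have fl := fixed mf_lower (fun k => erefl) cl.
have l0 : 0 <= limn mf_lower by rewrite -fl; case/andP: (mf_step_bound (limn mf_lower)).
have lu : limn mf_lower <= limn mf_upper.
  by apply: ler_lim => //; near=> k; exact: mf_lower_upper.
have E := mf_step_fixed_unique l0 lu fl fu.
have : (fun k => mf_upper k - mf_lower k) @ \oo --> (0 : R).
  have := cvgB cu cl; rewrite E subrr; exact.
move/cvgrPdist_le => /(_ e e0) [k _ /(_ k (leqnn k))] /=.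
by rewrite sub0r normrN => /(le_trans (ler_norm _)) ?; exists k.
Unshelve. all: by end_near.
Qed.

End MeanFieldIteration.

(** * Vanishing of the field variance *)

Section CycFerro.
Variables (R : realType) (beta h : R).
Hypotheses (beta0 : 0 < beta) (h0 : 0 <= h).
Local Open Scope classical_set_scope.

Fixpoint envelope_cst k : R :=
  if k is k'.+1 then 1 + 2 * beta * 4 * envelope_cst k' else 0.

Lemma envelope_cst_ge0 k : 0 <= envelope_cst k.
Proof. by elim: k => //= k IH; rewrite addr_ge0// !mulr_ge0// ltW. Qed.

(** Induction with the one-step envelopes at [D = 4]; the 15 is [d * N] for the row-sum deficit
    [d = 15 / N]. *)
Lemma envelopes n k (x : config n.+1) :
  let m := local_field (@A_cyc R n.+1) x in
  let G := \sum_i `|fixed_pt_gap (@A_cyc R n.+1) beta h x i| in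
  (\sum_i Num.max 0 (m i - mf_upper beta h k) <= envelope_cst k * (G + 15)) /\
  (\sum_i Num.max 0 (mf_lower beta h k - m i) <= envelope_cst k * (G + 15)).
Proof.
move=> m G; have hA := @regular_A_cyc R n.+1.
have N0 : 0 < n.+1%:R :> R by rewrite ltr0Sn.
have G0 : 0 <= G by apply: sumr_ge0.
have d0 : 0 <= 15 / n.+1%:R :> R by rewrite divr_ge0.
have m04 i := local_field01 hA x i.
elim: k => [|k [IH1 IH2]].
  rewrite /envelope_cst mul0r /mf_upper /mf_lower/=; split; rewrite big1// => i _;
    by apply: max_l; have := m04 i; rewrite /m; lra.
have U := upper_envelope hA h x (ltW beta0) (@cyc_bil1 R n) (mf_upper beta h k).
have L := lower_envelope hA h x (ltW beta0) d0 (@cyc_bil1 R n) (mf_lower beta h k).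
rewrite divfK ?lt0r_neq0// in L.
have b8 : 0 <= 2 * beta * 4 by rewrite !mulr_ge0// ltW.
split; [apply: (le_trans U)|apply: (le_trans L)]; rewrite -/G /= mulrDl mul1r -mulrA.
  by have := ler_wpM2l b8 IH1; rewrite -/m; lra.
by have := ler_wpM2l b8 IH2; rewrite -/m; lra.
Qed.

(** The mean minimises the sum of squared deviations. *)
Lemma T_stat_le_flat N (A : tensor R N) (x : config N) t : (0 < N)%N ->
  T_stat A x <= N%:R^-1 * \sum_i (local_field A x i - t) ^+ 2.
Proof.
move=> N0; have N0' : 0 < N%:R :> R by rewrite ltr0n.
rewrite /T_stat ler_pM2l ?invr_gt0//; set mb := mean_field A x.
have S : \sum_i local_field A x i = N%:R * mb.
  by rewrite /mb /mean_field mulrA mulfV ?mul1r// lt0r_neq0.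
have E : \sum_i (local_field A x i - t) ^+ 2 =
  \sum_i (local_field A x i - mb) ^+ 2 + N%:R * (mb - t) ^+ 2.
  have e i : (local_field A x i - t) ^+ 2 = (local_field A x i - mb) ^+ 2 +
    (2 * (mb - t) * local_field A x i + (t ^+ 2 - mb ^+ 2)) by ring.
  rewrite (eq_bigr _ (fun i _ => e i)) big_split big_split/= -mulr_sumr S sumr_const card_ord.
  by rewrite -[(t ^+ 2 - mb ^+ 2) *+ N]mulr_natr; ring.
by rewrite E lerDl mulr_ge0 ?sqr_ge0// ltW.
Qed.

Lemma cyc_ferro_T : little_op1 (@A_cyc R) beta h (fun N => T_stat (@A_cyc R N)).
Proof.
move=> e e0; apply/vanishingP.
have e16 : 0 < e / 16 by rewrite divr_gt0.
have [k gapk] := mf_gap_small beta0 h0 e16.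
set C := envelope_cst k; have C0 : 0 <= C := envelope_cst_ge0 k.
(* The final estimate is [16 C eta + 120 C / N + e / 4]; this choice makes its first term at most
   [e / 4]. *)
pose eta := e / (64 * (C + 1)).
have eta0 : 0 < eta by rewrite divr_gt0// mulr_gt0// ltr_wpDl.
have Ceta : C * eta <= e / 64.
  rewrite /eta mulrCA ler_wpM2l ?(ltW e0)// invfM mulrCA ler_piMr ?invr_ge0//.
  by rewrite ler_pdivrMr ?mul1r ?lerDl// ltr_wpDl.
apply: (@vanishing_near _ _ _ _ _ (fun N => [set x | eta ^+ 2 * N%:R <=
   \sum_i fixed_pt_gap (@A_cyc R N) beta h x i ^+ 2])); last first.
  apply: (@vanishing_gap _ _ 4%:R); last by rewrite exprn_gt0.
  by move=> N; exact: regular_A_cyc.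
have e4 : 0 < e / 4 by rewrite divr_gt0.
have [K _ HK] := near_invn (120 * C) e4.
exists K => // N /HK [N0 CN].
case: N N0 CN => // n _ CN x.
set A := @A_cyc R n.+1; have N0 : 0 < n.+1%:R :> R by rewrite ltr0Sn.
have T0 : 0 <= T_stat A x.
  by rewrite mulr_ge0 ?invr_ge0// sumr_ge0// => i _; exact: sqr_ge0.
rewrite /= ger0_norm// => Tx; rewrite leNgt; apply/negP => gapx.
have hA : regular 4%:R A := @regular_A_cyc R n.+1.
have [U L] := envelopes k x.
set G := \sum_i `|fixed_pt_gap A beta h x i| in U L.
have G1 : G <= 2 * eta * n.+1%:R by apply: sum_norm_le_sqr => //; exact: ltW.
set t := mf_lower beta h k.
have t04 : 0 <= t <= 4 := mf_lower_bound beta h k.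
(* One factor [|m_i - t|] is at most 4. The other is at most the excess over the upper iterate plus
   the deficit below the lower one plus the distance between the iterates. *)
have H : \sum_i (local_field A x i - t) ^+ 2 <= 4 * (C * (G + 15) + C * (G + 15) +
   e / 16 * n.+1%:R).
  have -> : e / 16 * n.+1%:R = \sum_(i < n.+1) e / 16.
    by rewrite sumr_const card_ord mulr_natr.
  apply: le_trans (_ : 4 * (\sum_i Num.max 0 (local_field A x i - mf_upper beta h k) +
    \sum_i Num.max 0 (t - local_field A x i) + \sum_(i < n.+1) e / 16) <= _); last first.
    by rewrite ler_pM2l// !lerD.
  rewrite -!big_split/= mulr_sumr; apply: ler_sum => i _.
  have mi := local_field01 hA x i; set y := local_field A x i in mi *.
  have n4 : `|y - t| <= 4 by rewrite ler_norml; lra.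
  rewrite -(real_normK (num_real _)) expr2 ler_pM//.
  have p1 : 0 <= Num.max 0 (y - mf_upper beta h k) by rewrite le_max lexx.
  have p2 : 0 <= Num.max 0 (t - y) by rewrite le_max lexx.
  have p3 : y - mf_upper beta h k <= Num.max 0 (y - mf_upper beta h k).
    by rewrite le_max lexx orbT.
  have p4 : t - y <= Num.max 0 (t - y) by rewrite le_max lexx orbT.
  rewrite -/t in gapk; have lu := mf_lower_upper h beta0 k.
  by rewrite ler_norml; lra.
have H2 := T_stat_le_flat A x t (ltn0Sn n).
have H3 : \sum_i (local_field A x i - t) ^+ 2 <= 8 * C * (2 * eta * n.+1%:R + 15) +
   e / 4 * n.+1%:R.
  apply: (le_trans H).
  have := ler_wpM2l C0 G1; lra.
have H4 : T_stat A x <= 16 * (C * eta) + 120 * C / n.+1%:R + e / 4.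
  apply: (le_trans H2); rewrite ler_pdivrMl// (le_trans H3)//.
  rewrite le_eqVlt; apply/orP; left; apply/eqP; field; exact: lt0r_neq0.
move: Tx; rewrite ltNge (le_trans H4)//; move: CN Ceta.
by move: (C * eta) (120 * C / n.+1%:R) => u v; lra.
Qed.

End CycFerro.

(** * The cyclic model with strong negative interaction *)

Section ProductMeasure.
Variables (R : realType) (N : nat).
Variable p : 'I_N -> R.
Hypothesis p01 : forall i, 0 <= p i <= 1.

Definition bern (x : config N) : R := \prod_i (if x i then p i else 1 - p i).

Lemma sum_prod_config (F : 'I_N -> bool -> R) :
  \sum_(x : config N) \prod_i F i (x i) = \prod_i (F i true + F i false).
Proof.
rewrite -(bigA_distr_bigA F); apply: eq_bigr => i _.
by rewrite (bigD1 true)//= (bigD1 false)//= big1 ?addr0// => -[].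
Qed.

Lemma bern_ge0 x : 0 <= bern x.
Proof.
by apply: prodr_ge0 => i _; case: (x i); have := p01 i; lra.
Qed.

Lemma bern_set (S : {set 'I_N}) :
  \sum_x bern x * \prod_(i in S) ind R x i = \prod_(i in S) p i.
Proof.
pose F i (s : bool) := (if s then p i else 1 - p i) * (if i \in S then s%:R else 1).
transitivity (\sum_(x : config N) \prod_i F i (x i)).
  by apply: eq_bigr => x _; rewrite (big_mkcond (mem S))/= -big_split.
rewrite sum_prod_config [RHS]big_mkcond/=; apply: eq_bigr => i _.
by rewrite /F; case: ifP => _ /=; ring.
Qed.

Lemma bern_sum1 : \sum_x bern x = 1.
Proof.
rewrite -[RHS](_ : \prod_(i in finset.set0) p i = 1); last by rewrite big_set0.
by rewrite -bern_set; apply: eq_bigr => x _; rewrite big_set0 mulr1.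
Qed.

Lemma bern_ind i : \sum_x bern x * ind R x i = p i.
Proof.
have := bern_set (finset.set1 i); rewrite big_set1 => <-.
by apply: eq_bigr => x _; rewrite big_set1.
Qed.

Lemma bern_ind3 i j k : i != j -> i != k -> j != k ->
  \sum_x bern x * (ind R x i * (ind R x j * ind R x k)) = p i * (p j * p k).
Proof.
move=> ij ik jk; have := bern_set (i |: (j |: finset.set1 k))%SET.
have E (u : 'I_N -> R) : \prod_(l in (i |: (j |: finset.set1 k))%SET) u l = u i * (u j * u k).
  rewrite big_setU1/=; last by rewrite !inE negb_or ij ik.
  by rewrite big_setU1/= ?big_set1// !inE.
by rewrite E => <-; apply: eq_bigr => x _; rewrite E.
Qed.

Variables (A : tensor R N) (D : R).
Hypothesis hA : regular D A.

(** The tensor is supported on triples of distinct sites, whose spins are independent. *)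
Lemma bern_tri : \sum_x bern x * tri A (ind R x) (ind R x) (ind R x) = tri A p p p.
Proof.
under eq_bigr do rewrite /tri mulr_sumr; rewrite exchange_big; apply: eq_bigr => i _.
under eq_bigr do rewrite mulr_sumr; rewrite exchange_big; apply: eq_bigr => j _.
under eq_bigr do rewrite mulr_sumr; rewrite exchange_big; apply: eq_bigr => k _.
transitivity (A i j k * \sum_x bern x * (ind R x i * (ind R x j * ind R x k))).
  by rewrite mulr_sumr; apply: eq_bigr => x _; ring.
case: (eqVneq i j) => [->|ij]; first by rewrite (tensor_diag hA) !mul0r.
case: (eqVneq j k) => [->|jk].
  by rewrite (tensorC12 hA) (tensorC23 hA) (tensor_diag hA) !mul0r.
case: (eqVneq i k) => [->|ik].
  by rewrite (tensorC23 hA) (tensor_diag hA) !mul0r.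
by rewrite bern_ind3// !mulrA.
Qed.

(* Gibbs' variational inequality at the product measure [bern]; its entropy
   is bounded below by [- ln s] times the expected number of ones. *)
Lemma sum_expR_hamiltonian_ge (beta h s : R) : 0 < s <= 1 -> (forall i, p i <= s) ->
  expR (beta / 3 * tri A p p p + (h - ln s) * \sum_i p i) <=
  \sum_(x : config N) expR (hamiltonian A beta h x).
Proof.
move=> /andP[s0 s1] ps.
pose Y x := hamiltonian A beta h x - ln s * \sum_i ind R x i.
set E := (X in expR X <= _).
have EY : \sum_x bern x * Y x = E.
  transitivity (beta / 3 * (\sum_x bern x * tri A (ind R x) (ind R x) (ind R x)) +
     (h - ln s) * \sum_i \sum_x bern x * ind R x i).
    rewrite exchange_big/= !mulr_sumr -big_split/=; apply: eq_bigr => x _.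
    by rewrite /Y hamiltonianE -mulr_sumr; ring.
  by rewrite bern_tri /E; under [X in _ + _ * X]eq_bigr do rewrite bern_ind.
have nus x : bern x <= expR (ln s * \sum_i ind R x i).
  rewrite mulr_sumr expR_sum /bern; apply: ler_prod => i _.
  rewrite /ind; case: (x i); have := p01 i; have := ps i.
    by rewrite mulr1 lnK ?posrE//; lra.
  by rewrite mulr0 expR0; lra.
apply: (@le_trans _ _ (\sum_x bern x * expR (Y x))).
  (* Jensen's inequality through the tangent of the exponential at the mean [E]. *)
  apply: (@le_trans _ _ (\sum_x bern x * (expR E * (1 + (Y x - E))))).
    have -> : \sum_x bern x * (expR E * (1 + (Y x - E))) =
      expR E * ((1 - E) * (\sum_x bern x) + \sum_x bern x * Y x).
      rewrite mulrDr !mulr_sumr -big_split/=; apply: eq_bigr => x _; ring.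
    by rewrite bern_sum1 EY ler_peMr ?expR_ge0//; lra.
  apply: ler_sum => x _; rewrite ler_wpM2l ?bern_ge0//.
  have -> : expR (Y x) = expR E * expR (Y x - E) by rewrite -expRD; congr expR; ring.
  by rewrite ler_wpM2l ?expR_ge0// expR_ge1Dx.
apply: ler_sum => x _.
have -> : expR (hamiltonian A beta h x) = expR (ln s * \sum_i ind R x i) * expR (Y x).
  by rewrite -expRD; congr expR; rewrite /Y; ring.
by rewrite ler_wpM2r ?expR_ge0.
Qed.

End ProductMeasure.

(** * Flat configurations against the partition function *)

Section CycAntiferro.
Variables (R : realType).

Lemma sum_expR_ind N (l : R) :
  \sum_(x : config N) expR (l * \sum_i ind R x i) = (1 + expR l) ^+ N.
Proof.
transitivity (\sum_(x : config N) \prod_i (fun (_ : 'I_N) (t : bool) => expR (l * t%:R)) i (x i)).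
  by apply: eq_bigr => x _; rewrite mulr_sumr expR_sum.
rewrite (@sum_prod_config R N (fun _ t => expR (l * t%:R)))/= prodr_const card_ord.
congr (_ ^+ _).
by rewrite mulr1 mulr0 expR0 addrC.
Qed.

Lemma gibbs_ratio N (A : tensor R N) beta h (E : set (config N)) :
  gibbs A beta h E = (\sum_(x in E) expR (hamiltonian A beta h x)) /
    (\sum_x expR (hamiltonian A beta h x)).
Proof.
rewrite /gibbs /gibbs_density /partition_function; set M := 2^-1 ^+ N : R.
have M0 : M != 0 by rewrite expf_neq0// invr_eq0.
have -> : \sum_x expR (hamiltonian A beta h x) * mu_prod R x =
  (\sum_x expR (hamiltonian A beta h x)) * M.
  by rewrite mulr_suml; apply: eq_bigr => x _; rewrite mu_prodE.
rewrite [RHS]mulr_suml; apply: eq_bigr => x _; rewrite mu_prodE -/M invfM.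
set Z := \sum_x _; set e := expR _.
have -> : Z^-1 * M^-1 * e * M = e / Z * (M^-1 * M) by ring.
by rewrite mulVf ?mulr1.
Qed.

Variables (b h : R).
Hypothesis b0 : 0 < b.

Section Fixed.
Variable q : R.
Hypothesis q0 : 0 < q.
Hypothesis q12 : q <= 2^-1.
Hypothesis qE : expR (h - 3 * b * q ^+ 2) = q.

(** With nearly constant fields the cubic form is at least about [3 r^3 N] at density [r]. Replacing
    [r^3] by its tangent at [q] makes the bound linear in the number of ones, so its exponential
    sums as a product. *)
Lemma flat_hamiltonian_le n (x : config n.+1) eta : 0 < eta ->
  T_stat (@A_cyc R n.+1) x <= eta ^+ 2 ->
  hamiltonian (@A_cyc R n.+1) (- b) h x <=
  (2 * b * q ^+ 3 + b * eta) * n.+1%:R + 5 * b +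
  (h - 3 * b * q ^+ 2) * \sum_i ind R x i.
Proof.
move=> eta0; set A := @A_cyc R n.+1; set N := n.+1%:R : R => Tx.
have N0 : 0 < N by rewrite /N ltr0Sn.
set mb := mean_field A x; set S := \sum_i ind R x i; pose r := N^-1 * S.
have SE : S = N * r by rewrite /r mulrA mulfV ?mul1r// lt0r_neq0.
have S0 : 0 <= S by apply: sumr_ge0 => i _; case/andP: (ind01 R x i).
have r0 : 0 <= r by rewrite mulr_ge0// invr_ge0 ltW.
have r1 : r <= 1.
  rewrite /r ler_pdivrMl// mulr1 (le_trans (ler_sum _ (fun i _ => proj2 (andP (ind01 R x i)))))//.
  by rewrite sumr_const card_ord.
have H1 : \sum_i `|local_field A x i - mb| <= 2 * eta * N.
  by apply: sum_norm_le_sqr => //; move: Tx; rewrite /T_stat ler_pdivrMl// mulrC.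
have H2 : mb * S - 2 * eta * N <= tri A (ind R x) (ind R x) (ind R x).
  rewrite triE lerBlDr; apply: le_trans (lerD (lexx _) H1).
  rewrite mulr_sumr -big_split/=; apply: ler_sum => i _.
  have /andP[i0 i1] := ind01 R x i; rewrite -local_fieldE.
  have := ler_wpM2r (normr_ge0 (local_field A x i - mb)) i1.
  have := ler_wpM2l i0 (ler_norm (- (local_field A x i - mb))); rewrite normrN.
  lra.
have H3 : 3 * r ^+ 2 - 15 / N <= mb := cyc_mean_field_ge R x.
have H4 : 3 * r ^+ 3 * N - 15 * r <= mb * S.
  have := ler_wpM2r S0 H3; rewrite {1}SE.
  have -> : (3 * r ^+ 2 - 15 / N) * (N * r) = 3 * r ^+ 3 * N - 15 * r.
    by field; exact: lt0r_neq0.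
  by [].
(* The tangent of the cube at [q]; the defect factors as [(r - q)^2 (r + 2 q)]. *)
have H5 : 3 * q ^+ 2 * r <= r ^+ 3 + 2 * q ^+ 3.
  have : 0 <= (r - q) ^+ 2 * (r + 2 * q).
    by rewrite mulr_ge0 ?sqr_ge0// addr_ge0// mulr_ge0// ltW.
  have -> : (r - q) ^+ 2 * (r + 2 * q) = r ^+ 3 + 2 * q ^+ 3 - 3 * q ^+ 2 * r by ring.
  lra.
rewrite hamiltonianE -/S.
have H6 : 3 * r ^+ 3 * N - 15 - 2 * eta * N <= tri A (ind R x) (ind R x) (ind R x) by lra.
have H7 := ler_wpM2l (ltW b0) H6.
have bN : 0 <= b * N by rewrite mulr_ge0// ltW.
have H8 := ler_wpM2l bN H5.
have e0 : 0 <= b * (eta * N) by rewrite !mulr_ge0// ltW.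
have -> : - b / 3 * tri A (ind R x) (ind R x) (ind R x) =
  - (b * tri A (ind R x) (ind R x) (ind R x)) / 3 by ring.
rewrite mulrBl [3 * b * _ * S]mulrAC SE.
set t := tri _ _ _ _ in H7 *; lra.
Qed.

(** Trial measure of density [s] off a block, of total mass [q N]. It saves one percent of the cubic
    term, worth [4 q N] as [b q^2 >= 400], and loses at most [q N] of entropy. *)
Lemma antiferro_partition_ge n : (40 <= n.+1)%N -> 400 <= b * q ^+ 2 ->
  expR ((2 * b * q ^+ 3 + 3 * q) * n.+1%:R) <=
  \sum_x expR (hamiltonian (@A_cyc R n.+1) (- b) h x).
Proof.
move=> N40 bq; set A := @A_cyc R n.+1; set N := n.+1%:R : R.
have N0 : 0 < N by rewrite /N ltr0Sn.
(* The block is a fraction [g] of the sites, between [1/5] and [1/4] once [N >= 40]. *)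
pose m := (n.+1 %/ 8)%N; pose g := 2 * m%:R / N.
have mN : (8 * m <= n.+1)%N by rewrite /m; lia.
have g4 : g <= 4^-1.
  rewrite ler_pdivrMr//; move: mN; rewrite -(ler_nat R) natrM -/N; lra.
have g5 : 5^-1 <= g.
  rewrite ler_pdivlMr//; have : (n.+1 <= 10 * m)%N by rewrite /m; lia.
  by rewrite -(ler_nat R) natrM -/N; lra.
have mE : 2 * m%:R = g * N by rewrite /g divfK// lt0r_neq0.
pose s := q / (1 - g).
have g1 : 0 < 1 - g by lra.
have s0 : 0 < s by rewrite divr_gt0.
have s1 : s <= 1 by rewrite ler_pdivrMr//; have := q12; lra.
pose f := @off_block R n m.
have f01 i : 0 <= f i <= 1 by rewrite /f /off_block; case: leqP => _ /=; lra.
pose p i := s * f i.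
have ps i : p i <= s.
  by have /andP[_ f1] := f01 i; rewrite /p ler_piMr ?(ltW s0).
have p01 i : 0 <= p i <= 1.
  by rewrite mulr_ge0 ?(ltW s0) ?(le_trans (ps i))//; case/andP: (f01 i).
have s01 : 0 < s <= 1 by rewrite s0.
have hA := @regular_A_cyc R n.+1.
apply: le_trans (sum_expR_hamiltonian_ge p01 hA (- b) h s01 ps).
rewrite ler_expR.
have sp : \sum_i p i = q * N.
  rewrite -mulr_sumr sum_off_block// mE /s -/N; field; exact: lt0r_neq0.
have tp : tri A p p p = s ^+ 3 * tri A f f f.
  rewrite /tri mulr_sumr; apply: eq_bigr => i _; rewrite mulr_sumr; apply: eq_bigr => j _.
  by rewrite mulr_sumr; apply: eq_bigr => k _; rewrite /p; ring.
have tf : tri A f f f <= 3 * N * (1 - 3 * g + 5 / 2 * g ^+ 2).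
  apply: (le_trans (cyc_tri_off_block R mN)).
  have -> : m%:R = g * N / 2 by rewrite -mE mulrC mulKf.
  by rewrite -/N le_eqVlt; apply/orP; left; apply/eqP; field; exact: lt0r_neq0.
have g3 : 1 - 3 * g + 5 / 2 * g ^+ 2 <= 99 / 100 * (1 - g) ^+ 3.
  have h1 : 0 <= (g - 5^-1) * (4^-1 - g) by rewrite mulr_ge0//; lra.
  have h2 : 0 <= (g - 5^-1) * (4^-1 - g) * g by rewrite mulr_ge0//; lra.
  have -> : (1 - g) ^+ 3 = 1 - 3 * g + 3 * g ^+ 2 - g ^+ 3 by ring.
  nra.
have tq : tri A p p p <= 3 * N * (99 / 100 * q ^+ 3).
  rewrite tp; have s3 : 0 <= s ^+ 3 by rewrite exprn_ge0// ltW.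
  apply: (le_trans (ler_wpM2l s3 tf)).
  have N3 : 0 <= 3 * N by rewrite mulr_ge0// ltW.
  have := ler_wpM2l s3 (ler_wpM2l N3 g3).
  have -> : s ^+ 3 * (3 * N * (99 / 100 * (1 - g) ^+ 3)) = 3 * N * (99 / 100 * q ^+ 3).
    by rewrite /s; field; exact: lt0r_neq0.
  by [].
(* By [qE], [ln q = h - 3 b q^2]; concentrating the mass off the block costs [- ln (1 - g) <= 1]. *)
have ls : h - ln s >= 3 * b * q ^+ 2 - 1.
  have lq : ln q = h - 3 * b * q ^+ 2 by rewrite -{1}qE expRK.
  have lg : ln (1 - g) >= - 1.
    have H : expR (- 1) <= 1 - g.
      have := expR_ge1Dx (1 : R); rewrite expRN => e2.
      rewrite (@le_trans _ _ 2^-1)//; last lra.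
      by rewrite lef_pV2 ?posrE ?expR_gt0.
    by rewrite -[X in X <= _]expRK ler_ln// posrE expR_gt0.
  rewrite /s ln_div ?posrE// lq; lra.
have qN : 0 <= q * N by rewrite mulr_ge0// ltW.
have H1 := ler_wpM2r qN ls.
have H2 := ler_wpM2l (ltW b0) tq.
have H3 := ler_wpM2r qN bq.
rewrite sp.
have -> : - b / 3 * tri A p p p = - (b * tri A p p p) / 3 by ring.
lra.
Qed.

(** With [b * eta = q] the flat configurations weigh at most [e^(5 b + (2 b q^3 + 2 q) N)], a factor
    [e^(5 b - q N)] relative to the lower bound on the partition function. *)
Lemma antiferro_T_vanishing : 400 <= b * q ^+ 2 ->
  vanishing (@A_cyc R) (- b) h
    (fun N => [set x | T_stat (@A_cyc R N) x < (q / b) ^+ 2]%classic).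
Proof.
move=> bq; set eta := q / b; have eta0 : 0 < eta by rewrite divr_gt0.
have bound n : (40 <= n.+1)%N -> gibbs (@A_cyc R n.+1) (- b) h
    [set x | T_stat (@A_cyc R n.+1) x < eta ^+ 2]%classic <=
    expR (5 * b) / q / n.+1%:R.
  move=> N40; set A := @A_cyc R n.+1; set N := n.+1%:R : R.
  have N0 : 0 < N by rewrite /N ltr0Sn.
  rewrite gibbs_ratio; set Z := (X in _ / X).
  have ZL : expR ((2 * b * q ^+ 3 + 3 * q) * N) <= Z := antiferro_partition_ge N40 bq.
  have Z0 : 0 < Z := lt_le_trans (expR_gt0 _) ZL.
  rewrite ler_pdivrMr//.
  pose C := (2 * b * q ^+ 3 + b * eta) * N + 5 * b.
  apply: (@le_trans _ _ (expR C * (1 + q) ^+ n.+1)).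
    rewrite -{1}qE -sum_expR_ind mulr_sumr big_mkcond/=; apply: ler_sum => x _.
    case: ifPn => [/set_mem/= Tx|_]; last by rewrite mulr_ge0 ?expR_ge0.
    by rewrite -expRD ler_expR; apply: flat_hamiltonian_le => //; exact: ltW.
  have q1 : (1 + q) ^+ n.+1 <= expR (q * N).
    rewrite mulrC /N expRM_natl ler_pXn2r ?nnegrE ?expR_ge0 ?expR_ge1Dx//.
    by rewrite addr_ge0// ltW.
  apply: (@le_trans _ _ (expR (5 * b) / q / N * expR ((2 * b * q ^+ 3 + 3 * q) * N))); last first.
    by rewrite ler_wpM2l// !divr_ge0 ?expR_ge0// ltW.
  apply: (le_trans (ler_wpM2l (expR_ge0 _) q1)).
  have e1 : expR (2 * b * q ^+ 3 * N + 3 * q * N) = expR ((2 * b * q ^+ 3 + 3 * q) * N).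
    by congr expR; ring.
  rewrite -expRD; have -> : C + q * N = 5 * b + ((2 * b * q ^+ 3 + 3 * q) * N - q * N).
    by rewrite /C /eta; field; exact: lt0r_neq0.
  rewrite !expRD -!mulrA ler_pM2l ?expR_gt0// [leLHS]mulrC !mulrA ler_pM2r ?expR_gt0//.
  rewrite expRN -invfM lef_pV2 ?posrE ?expR_gt0 ?mulr_gt0//.
  by have := expR_ge1Dx (q * N); lra.
move=> e e0; have [K _ HK] := near_invn (expR (5 * b) / q) e0.
exists (maxn K 40) => // N /=; rewrite geq_max => /andP[/HK[N0 NC] N40].
case: N N0 NC N40 => // n _ NC N40.
exact: le_trans (bound n N40) NC.
Qed.

End Fixed.
End CycAntiferro.

Lemma cyc_antiferro_T (R : realType) (h : R) : exists2 L : R, 0 < L &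
  forall beta, beta <= - L -> exists2 c : R, 0 < c &
  vanishing (@A_cyc R) beta h (fun N => [set x | T_stat (@A_cyc R N) x < c]%classic).
Proof.
(* A solution [q <= q0] satisfies [q <= 1/2] and [h - 3 b q^2 <= h - 1200], that is,
   [b q^2 >= 400]. *)
pose q0 : R := Num.min 2^-1 (expR (h - 1200)).
have q00 : 0 < q0 by rewrite lt_min invr_gt0 ltr0n expR_gt0.
(* This size of [b] gives [q0 e^(3 b q0^2) >= e^h], so the intermediate value theorem finds [q] in
   [[0, q0]]. *)
exists (expR h / (3 * q0 ^+ 3)); first by rewrite divr_gt0 ?expR_gt0// mulr_gt0// exprn_gt0.
move=> beta bL; pose b := - beta.
have bE : beta = - b by rewrite /b opprK.
have Lb : expR h / (3 * q0 ^+ 3) <= b by rewrite /b lerNr.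
have b0 : 0 < b.
  by apply: lt_le_trans Lb; rewrite divr_gt0 ?expR_gt0// mulr_gt0// exprn_gt0.
have q0b : expR h <= q0 * expR (3 * b * q0 ^+ 2).
  have := expR_ge1Dx (3 * b * q0 ^+ 2) => H.
  apply: (@le_trans _ _ (q0 * (3 * b * q0 ^+ 2))); last first.
    by rewrite ler_pM2l//; lra.
  by move: Lb; rewrite ler_pdivrMr ?mulr_gt0 ?exprn_gt0//; lra.
pose f (q : R) := q * expR (3 * b * q ^+ 2).
have cf : continuous f.
  move=> q; apply: cvgM; first exact: cvg_id.
  apply: (@continuous_cvg _ _ _ _ _ _ (@expR R)); first exact: continuous_expR.
  by apply: cvgM; [exact: cvg_cst|exact: exprn_continuous].
have [|q qI fq] := @IVT R f 0 q0 (expR h) (ltW q00) (continuous_subspaceT cf).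
  by rewrite /f mul0r min_l ?max_r ?mulr_ge0 ?expR_ge0 ?(ltW q00)//.
move: qI; rewrite in_itv/= => /andP[q0' qq0].
have qp : 0 < q.
  rewrite lt_neqAle q0' andbT; apply/eqP => z.
  by move: fq (expR_gt0 h); rewrite /f -z mul0r => <-; rewrite ltxx.
have qE : expR (h - 3 * b * q ^+ 2) = q.
  by rewrite expRD -fq /f expRN mulfK// lt0r_neq0// expR_gt0.
have q12 : q <= 2^-1 by rewrite (le_trans qq0)// ge_min lexx.
have bq : 400 <= b * q ^+ 2.
  have : expR (h - 3 * b * q ^+ 2) <= expR (h - 1200).
    by rewrite qE (le_trans qq0)// ge_min lexx orbT.
  by rewrite ler_expR; lra.
exists ((q / b) ^+ 2); first by rewrite exprn_gt0// divr_gt0.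
by rewrite bE; exact: antiferro_T_vanishing qE bq.
Qed.

Theorem theorem2p4 (R : realType) :
  (forall beta0 h0 : R, 0 < beta0 -> 0 <= h0 ->
     little_op1 (A_cyc R) beta0 h0 (fun N => T_stat (A_cyc R N))) /\
  (forall h0 : R, exists2 L : R, 0 < L &
     forall beta0 : R, beta0 <= - L ->
       (exists2 c : R, 0 < c &
          whp (A_cyc R) beta0 h0
            (fun N => [set x | c <= T_stat (A_cyc R N) x]%classic)) /\
       MPLE_exists_whp (A_cyc R) beta0 h0 /\
       jointly_sqrt_consistent (A_cyc R) beta0 h0) /\
  (forall beta0 h0 : R,
     Omega_p1 (A_int R) beta0 h0 (fun N => T_stat (A_int R N)) /\
     MPLE_exists_whp (A_int R) beta0 h0 /\
     jointly_sqrt_consistent (A_int R) beta0 h0).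
Proof.
split; first exact: cyc_ferro_T.
split=> [h0|beta0 h0].
  have [L L0 HL] := cyc_antiferro_T h0; exists L => // beta0 /HL[c c0 vT].
  have hA N := @regular_A_cyc R N.
  split; last first.
    by split; [exact: (@MPLE_exists_whp_of_T _ _ _ _ _ hA _ c0 vT)
              |exact: (@jointly_sqrt_consistent_of_T _ _ _ _ _ hA _ c0 vT)].
  exists c => //; apply: vanishing_whp; apply: vanishing_near vT; exists 0%N => // N _ x /=.
  by move/negP; rewrite -ltNge.
have [c c0 vT] := int_T_vanishing beta0 h0.
have hA N := @regular_A_int R N.
split; first exact: (@Omega_p1_of_T _ _ _ _ _ c0 vT).
by split; [exact: (@MPLE_exists_whp_of_T _ _ _ _ _ hA _ c0 vT)
          |exact: (@jointly_sqrt_consistent_of_T _ _ _ _ _ hA _ c0 vT)].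
Qed.
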